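(* Let $\sigma\in\mathbb{C}$ and let $Z_\sigma^{[p,q]}(\alpha)$ be the zonal spherical function of $SO_0(p,q)$ defined in the context. The zonal spherical functions of the de Sitter groups $SO(4,1)$, $SO(3,2)$ and of the conformal group $SO(4,2)$ are given, for $\alpha\in\mathbb{R}$, by $$Z_\sigma^{[4,1]}(\alpha)={}_2F_1\left(-\tfrac\sigma2,\tfrac{1-\sigma}2;2;\tanh^2\alpha\right)(\cosh\alpha)^\sigma,$$ $$Z_\sigma^{[3,2]}(\alpha)=\frac1{\cosh\alpha}\sum_{l=0}^\infty\frac{(\frac12)_l}{l!}F_2\left(-\tfrac\sigma2,-l,-l;\tfrac32,1;1,1\right)(\tanh\alpha)^{2l}$$ $$=\frac1{\cosh\alpha}\sum_{l=0}^\infty\frac{(\frac12)_l\left(\frac{3+\sigma}2\right)_l\left(\frac\sigma2+1\right)_l}{(l!)^2\left(\frac32\right)_l}\;{}_3F_2\left(-\tfrac\sigma2,-l,-l;\,-\tfrac{\sigma+1}2-l,\,-\tfrac\sigma2-l;\,1\right)(\tanh\alpha)^{2l},$$ $$Z_\sigma^{[4,2]}(\alpha)=\frac1{\cosh\alpha}\sum_{l=0}^\infty\frac{(\frac12)_l}{l!}F_2\left(-\tfrac\sigma2,-l,-l;2,1;1,1\right)(\tanh\alpha)^{2l}$$ $$=\frac1{\cosh\alpha}\sum_{l=0}^\infty\frac{(\frac12)_l\left(\frac\sigma2+2\right)_l\left(\frac\sigma2+1\right)_l}{(l!)^2\,\Gamma(l+2)}\;{}_3F_2\left(-\tfrac\sigma2,-l,-l;\,-\tfrac\sigma2-l-1,\,-\tfrac\sigma2-l;\,1\right)(\tanh\alpha)^{2l}.$$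 (The expressions containing ${}_3F_2$ are understood for those $\sigma$ for which no denominator in the terminating ${}_3F_2$ vanishes.)
   Context: $(a)_n=a(a+1)\cdots(a+n-1)$, $(a)_0=1$, is the Pochhammer symbol; ${}_2F_1$ and ${}_3F_2$ are the usual hypergeometric series, and the terminating Appell function is $$F_2(a,-l,-l;c,c';1,1)=\sum_{m,n=0}^l\frac{(a)_{m+n}(-l)_m(-l)_n}{(c)_m(c')_n\,m!\,n!}.$$ The zonal spherical function of $SO_0(p,q)$ is the matrix element of the hyperbolic rotation by $\alpha$ in the plane $(k_1,k_{p+q})$ with respect to the $SO(p)\otimes SO(q)$-invariant vector, in the representation $F(k)\mapsto F(g^{-1}k)$ on even homogeneous functions of degree $\sigma$ on the cone $k_1^2+\dots+k_q^2-k_{q+1}^2-\dots-k_{p+q}^2=0$, $k\neq 0$, normalized by $Z_\sigma^{[p,q]}(0)=1$. Explicitly, $$Z_\sigma^{[p,q]}(\alpha)=\int_{S^{q-1}}\int_{S^{p-1}}\Lambda^{\sigma/2},\qquad \Lambda=1+(x^2+y^2)\sinh^2\alpha-2xy\sinh\alpha\cosh\alpha>0,$$ where the integrals are with respect to the rotation-invariant probability measures on the spheres ($S^0=\{\pm1\}$), $y$ is a fixed Cartesian coordinate of the point of $S^{q-1}\subset\mathbb{R}^q$, and $x$ is a fixed Cartesian coordinate of the point of $S^{p-1}\subset\mathbb{R}^p$. For example, for $p\geq 3$ and $q=2$, $$Z_\sigma^{[p,2]}(\alpha)=\frac{\Gamma(p/2)}{2\pi^{3/2}\Gamma(\frac{p-1}2)}\int_0^{2\pi}\int_{-1}^1\Lambda^{\sigma/2}(1-x^2)^{\frac{p-3}2}\,dx\,d\phi\quad\text{with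 } y=\cos\phi .$$ *)

(* Defs.v *)
From HB Require Import structures.
From mathcomp Require Import all_boot all_order all_algebra.
From mathcomp Require Import all_classical all_reals all_analysis.
From mathcomp Require Export complex.

Set Implicit Arguments.
Unset Strict Implicit.
Unset Printing Implicit Defensive.

Import Order.TTheory GRing.Theory Num.Theory.
Import numFieldNormedType.Exports.

Local Open Scope classical_set_scope.
Local Open Scope ring_scope.
Local Open Scope complex_scope.

Section Hyperbolic.
Variable R : realType.
Implicit Types a : R.

Definition sinh a : R := (expR a - expR (- a)) / 2.
Definition cosh a : R := (expR a + expR (- a)) / 2.
Definition tanh a : R := sinh a / cosh a.

End Hyperbolic.

(* R[i] gets the topology of its modulus, which numFieldNormedType only
   declares on abstract field types and on R[i]^o. *)
#[export, non_forgetful_inheritance]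
HB.instance Definition _ (R : realType) := NormedModule.copy R[i] (R[i])^o.

Section Hypergeometric.
Variable R : realType.
Implicit Types (a b c z : R[i]) (s t : seq R[i]).

Definition poch a (n : nat) : R[i] := \prod_(k < n) (a + k%:R).

Definition pFq_term s t z (n : nat) : R[i] :=
  (\prod_(a <- s) poch a n) / ((\prod_(b <- t) poch b n) * n`!%:R) * z ^+ n.

(* If one of the upper parameters is -l, the terms of index > l vanish (also
   when a lower parameter vanishes there, as x / 0 = 0) and the limit is the
   finite sum over n <= l. *)
Definition pFq s t z : R[i] := limn (series (pFq_term s t z)).

Definition hyp2F1 a b c z : R[i] := pFq [:: a; b] [:: c] z.

Definition hyp3F2 a1 a2 a3 b1 b2 z : R[i] :=
  pFq [:: a1; a2; a3] [:: b1; b2] z.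

(* F_2(a, -l, -l; c, c'; 1, 1) *)
Definition appellF2 (l : nat) a c c' : R[i] :=
  \sum_(m < l.+1) \sum_(n < l.+1)
    poch a (m + n) * poch (- l%:R) m * poch (- l%:R) n
      / (poch c m * poch c' n * m`!%:R * n`!%:R).

End Hypergeometric.

Section Spheres.
Variables (R : realType) (n : nat).

Definition sphere : set (n.-tuple R) :=
  [set v | \sum_(i < n) tnth v i ^+ 2 = 1].

Definition mxact (A : 'M[R]_n) (v : n.-tuple R) : n.-tuple R :=
  [tuple \sum_(j < n) A i j * tnth v j | i < n].

(* Invariance is under O(n) rather than SO(n) so that n = 1 gives the uniform
   measure on {1, -1}; for n >= 2 both conditions single out the same
   probability measure. *)
Definition uniform_on_sphere (mu : probability (n.-tuple R) R) : Prop :=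
  mu sphere = 1%E /\
  forall (A : 'M[R]_n) (E : set (n.-tuple R)),
    A *m A^T = 1%:M -> measurable E -> mu (mxact A @^-1` E) = mu E.

End Spheres.

Section Zonal.
Variable R : realType.

(* x ^ s = exp (s ln x), for x > 0 *)
Definition cpow (x : R) (s : R[i]) : R[i] :=
  (x `^ complex.Re s)%:C
    * (cos (complex.Im s * ln x) +i* sin (complex.Im s * ln x)).

Definition cintegral d (T : measurableType d) (mu : {measure set T -> \bar R})
    (D : set T) (f : T -> R[i]) : R[i] :=
  Rintegral mu D (fun t => complex.Re (f t))
    +i* Rintegral mu D (fun t => complex.Im (f t)).

Definition Lambda (alpha x y : R) : R :=
  1 + (x ^+ 2 + y ^+ 2) * sinh alpha ^+ 2
    - 2 * x * y * sinh alpha * cosh alpha.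

(* [mu n] plays the role of the invariant probability measure on the unit
   sphere of R^n; [i] and [j] are the indices of the chosen coordinates. *)
Definition zonal (mu : forall n, probability (n.-tuple R) R) (p q : nat)
    (i : 'I_p) (j : 'I_q) (sigma : R[i]) (alpha : R) : R[i] :=
  cintegral (mu q) (@sphere R q) (fun v =>
    cintegral (mu p) (@sphere R p) (fun u =>
      cpow (Lambda alpha (tnth u i) (tnth v j)) (sigma / 2))).

End Zonal.

(* Main.v *)
(** Put s = - sigma / 2 and t = tanh alpha. If a, b are the two numbers
    x y +- sqrt ((1 - x^2)(1 - y^2)), which lie in [-1, 1], then
    Lambda = (1 - a t)(1 - b t) / (1 - t^2) and cosh alpha = (1 - t^2)^(-1/2).
    Hence cosh alpha * Lambda^(-s) is a power series in t with a majorant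
    independent of (x, y), and it can be integrated term by term. Averaging over
    x |-> - x leaves the even powers of t; the coefficient of t^(2l) is then a
    polynomial in x^2 and y^2, given by a weighted form of Mehler's formula that
    rests on the Pfaff-Saalschutz theorem. By invariance under reflections, the
    moments of a coordinate on the sphere of R^n are (1/2)_m / (n/2)_m, which
    turns this polynomial into Appell's F_2. Two applications of the
    Chu-Vandermonde theorem transform F_2 into 3F2. When q = 1, y^2 = 1 and
    Lambda is the square of cosh alpha * (1 - x y t), so that the binomial
    series alone suffices. *)

Require Import Defs.
From mathcomp Require Import all_boot all_order all_algebra.
From mathcomp Require Import all_classical all_reals all_analysis.
From mathcomp Require Import measurable_realfun ring lra zify.
Import Order.TTheory GRing.Theory Num.Theory.
Import numFieldNormedType.Exports.
Local Open Scope classical_set_scope.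
Local Open Scope ring_scope.
Local Open Scope complex_scope.

Set Implicit Arguments.
Unset Strict Implicit.
Unset Printing Implicit Defensive.

(** Since sinh^2 = t^2 / (1 - t^2) and sinh cosh = t / (1 - t^2), Lambda = 1 + w with w = ((x^2 +
    y^2) t^2 - 2 x y t) / (1 - t^2). Thus cosh alpha Lambda^(-s) is Mehler's kernel (1 - t^2)^(-1/2)
    exp(- w) with the term in w^k / k! weighted by (s)_k. This explains the prefactor 1 / cosh
    alpha: with the exponent 1/2 the coefficients factor, because 1/2 is also the parameter in (2
    r)! = 4^r r! (1/2)_r, and the sums that occur are then balanced. As |w| may exceed 1, the
    expansion in w serves the algebra only. Convergence rests on the real numbers a and b: it is
    reduced to binomial series at points of modulus at most |t| or t^2, and complex powers are taken
    of positive reals only. Algebra and analysis meet in the identity [mehler]. Each expansion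
    carries a majorant and a bound on its tail, chosen before x and y. Both integrals are then
    limits of integrals of polynomials, at an explicit rate, and the inner integral is measurable in
    y as a uniform limit of polynomials. *)

(** * Rearrangements of finite sums *)

Section BigSums.
Variable K : pzRingType.
Implicit Types f : nat -> K.

Lemma sum_binS n f :
  \sum_(j < n.+2) 'C(n.+1, j)%:R * f j =
  \sum_(j < n.+1) 'C(n, j)%:R * f j + \sum_(j < n.+1) 'C(n, j)%:R * f j.+1.
Proof.
rewrite big_ord_recl bin0 [in RHS]big_ord_recl bin0 -addrA; congr (_ + _).
under eq_bigr do rewrite /= /bump /= add1n binS natrD mulrDl.
rewrite big_split; congr (_ + _).
by rewrite big_ord_recr /= bin_small // mul0r addr0.
Qed.

Lemma sum_bin_mul n f :
  \sum_(j < n.+1) 'C(n, j)%:R * (j%:R * f j) =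
  \sum_(j < n.+1) 'C(n, j)%:R * ((n - j)%:R * f j.+1).
Proof.
rewrite big_ord_recl mul0r mulr0 add0r [in RHS]big_ord_recr /=.
rewrite subnn mul0r mulr0 addr0; apply: eq_bigr => j _.
rewrite /= /bump /= add1n !mulrA -!natrM; congr (_%:R * _).
by rewrite mulnC mul_bin_left mulnC.
Qed.

Lemma sum_diag (F : nat -> nat -> K) n :
  \sum_(k < n) \sum_(i < k.+1) F i (k - i)%N =
  \sum_(i < n) \sum_(j < n - i) F i j.
Proof.
elim: n => [|n IH]; first by rewrite !big_ord0.
rewrite big_ord_recr IH /= [in RHS]big_ord_recr /= subSn // subnn big_ord1.
rewrite [X in _ + X = _]big_ord_recr /= subnn addrA; congr (_ + _).
rewrite -big_split; apply: eq_bigr => i _ /=.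
by rewrite subSn ?big_ord_recr // ltnW.
Qed.

Lemma sum_ord_widen n m f : (n <= m)%N -> (forall j, (n <= j)%N -> f j = 0) ->
  \sum_(j < m) f j = \sum_(j < n) f j.
Proof.
move=> nm f_large; rewrite -!(big_mkord xpredT) (big_cat_nat (n := n)) //=.
rewrite [X in _ + X]big_nat_cond [X in _ + X]big1 ?addr0 //.
by move=> j /andP[/andP[/f_large]].
Qed.

Lemma sum_ord_even n f : (forall j, odd j -> f j = 0) ->
  (forall j, (n <= j)%N -> f j = 0) ->
  \sum_(j < n) f j = \sum_(i < n) f i.*2.
Proof.
move=> f_odd f_large.
have even_split m : \sum_(j < m.*2) f j = \sum_(i < m) f i.*2.
  elim: m => [|m IH]; first by rewrite !big_ord0.
  by rewrite doubleS !big_ord_recr /= IH (f_odd m.*2.+1) ?addr0 //= odd_double.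
by rewrite -even_split -(@sum_ord_widen n n.*2) // -addnn leq_addr.
Qed.

End BigSums.

(** * Summation theorems for Pochhammer symbols *)

Section Pochhammer.
Variable R : realType.
Local Notation C := R[i].
Implicit Types a b c s x y : C.

Lemma poch0 a : poch a 0 = 1.
Proof. by rewrite /poch big_ord0. Qed.

Lemma pochSr a n : poch a n.+1 = poch a n * (a + n%:R).
Proof. by rewrite /poch big_ord_recr. Qed.

Lemma pochD a m n : poch a (m + n) = poch a m * poch (a + m%:R) n.
Proof.
elim: n => [|n IH]; first by rewrite addn0 poch0 mulr1.
by rewrite addnS !pochSr IH -mulrA natrD addrA.
Qed.

Lemma pochSl a n : poch a n.+1 = a * poch (a + 1) n.
Proof. by rewrite -add1n pochD pochSr poch0 mul1r addr0. Qed.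

Lemma poch1 n : poch 1 n = n`!%:R :> C.
Proof.
elim: n => [|n IH]; first by rewrite poch0.
by rewrite pochSr IH factS mulnC natrM mulrS.
Qed.

Lemma poch_gt0 a n : 0 < a -> 0 < poch a n.
Proof.
by move=> a0; rewrite /poch prodr_gt0 // => k _; rewrite ltr_wpDr // ler0n.
Qed.

Lemma poch_neq0 a n : 0 < a -> poch a n != 0.
Proof. by move=> /(poch_gt0 n); rewrite lt0r => /andP[]. Qed.

Lemma fact_neq0 n : (n`!%:R : C) != 0.
Proof. by rewrite pnatr_eq0 -lt0n fact_gt0. Qed.

Lemma poch_oppn l m : poch (- l%:R) m = (-1) ^+ m * (l ^_ m)%:R :> C.
Proof.
elim: m => [|m IH]; first by rewrite poch0 ffactn0 mulr1.
rewrite pochSr IH ffactnSr natrM exprS.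
have [lm|ml] := leqP l.+1 m; first by rewrite (ffact_small lm); ring.
by rewrite natrB //; ring.
Qed.

Lemma poch_reflect a n : poch (1 - a - n%:R) n = (-1) ^+ n * poch a n.
Proof.
elim: n a => [|n IH] a; first by rewrite !poch0 mulr1.
rewrite pochSr pochSl.
have -> : 1 - a - n.+1%:R = 1 - (a + 1) - n%:R by ring.
by rewrite IH exprS; ring.
Qed.

(** Pascal's rule splits the sum for n + 1; the two terms with the same j carry the extra factors x
    + j and y + n - j, which add up to x + y + n. *)
Lemma chu_vandermonde x y n :
  \sum_(j < n.+1) 'C(n, j)%:R * (poch x j * poch y (n - j)) = poch (x + y) n.
Proof.
elim: n => [|n IH]; first by rewrite big_ord1 bin0 !poch0 !mulr1.
rewrite (sum_binS n (fun j => poch x j * poch y (n.+1 - j))).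
rewrite -big_split pochSr -IH mulr_suml; apply: eq_bigr => j _ /=.
have jn : (j <= n)%N by rewrite -ltnS.
by rewrite subSS subSn // !pochSr natrB //; ring.
Qed.

(* Division-free form of the Pfaff-Saalschutz theorem: the fourth parameter of
   the usual statement is 1 + a + b - c - n. *)
Lemma pfaff_saalschutz n a b c :
  \sum_(r < n.+1) 'C(n, r)%:R * (poch a r * poch b r *
     (poch (c + r%:R) (n - r) * poch (c - a - b) (n - r))) =
  poch (c - a) n * poch (c - b) n.
Proof.
elim: n a b c => [|n IH] a b c.
  by rewrite big_ord1 bin0 !poch0 !mulr1.
rewrite (sum_binS n (fun r => poch a r * poch b r *
     (poch (c + r%:R) (n.+1 - r) * poch (c - a - b) (n.+1 - r)))) /=.
pose e := c - a - b; pose D := c + n%:R; rewrite -/e.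
pose g r := poch a r * poch b r * (D * poch (c + r%:R) (n - r) * poch e (n -
  r)).
(* As (D - a)(D - b) = D (D - a - b) + a b, the induction hypothesis is used both at (a, b, c) and
   at (a + 1, b + 1, c + 1). *)
have -> : poch (c - a) n.+1 * poch (c - b) n.+1 =
  D * (D - a - b) * (poch (c - a) n * poch (c - b) n)
  + a * b * (poch (c + 1 - (a + 1)) n * poch (c + 1 - (b + 1)) n).
  have -> : c + 1 - (a + 1) = c - a by ring.
  have -> : c + 1 - (b + 1) = c - b by ring.
  by rewrite !pochSr /D; ring.
rewrite -(IH a b c) -(IH (a + 1) (b + 1) (c + 1)) -/e.
have -> : c + 1 - (a + 1) - (b + 1) = e - 1 by rewrite /e; ring.
have -> : \sum_(r < n.+1) 'C(n, r)%:R * (poch a r * poch b r *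
     (poch (c + r%:R) (n.+1 - r) * poch e (n.+1 - r))) =
  D * (D - a - b) * (\sum_(r < n.+1) 'C(n, r)%:R * (poch a r * poch b r *
     (poch (c + r%:R) (n - r) * poch e (n - r))))
  - \sum_(r < n.+1) 'C(n, r)%:R * (r%:R * g r).
  rewrite mulr_sumr -sumrB; apply: eq_bigr => r _.
  have rn : (r <= n)%N by rewrite -ltnS.
  by rewrite subSn // !pochSr natrB // /g /D /e; ring.
(* The remainder carries the weight r; [sum_bin_mul] shifts it by one, after which the identity
   holds term by term. *)
rewrite -addrA; congr (_ + _); rewrite sum_bin_mul mulr_sumr addrC -sumrB.
apply: eq_bigr => r _; have : (r <= n)%N by rewrite -ltnS.
rewrite leq_eqVlt => /predU1P[-> | rn].
  by rewrite subSS subnn !poch0 !pochSl; ring.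
rewrite /g subSS -[(n - r)%N](@subnSK r n) //; set k := (n - r.+1)%N.
have -> : D = c + r%:R + 1 + k%:R.
  by rewrite /D -[in LHS](subnK rn) natrD -/k; ring.
rewrite [poch a _]pochSl [poch b _]pochSl [poch (e - 1) _]pochSl subrK.
have -> : c + r.+1%:R = c + r%:R + 1 by ring.
have -> : c + 1 + r%:R = c + r%:R + 1 by ring.
by rewrite !pochSr; ring.
Qed.
End Pochhammer.

(** * Appell's F_2 at unit arguments and its 3F2 form *)

Section Appell.
Variable R : realType.
Local Notation C := R[i].
Implicit Types a b c s x y : C.

(** The terminating Gauss sum 2F1(- k, a; c; 1) multiplied through by (c)_k. It is [chu_vandermonde]
    for a and 1 - c - k, the second symbol being reversed by [poch_reflect]. *)
Lemma gauss_sum k a c :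
  \sum_(m < k.+1) 'C(k, m)%:R * ((-1) ^+ m * poch a m * poch (c + m%:R) (k - m))
  = poch (c - a) k.
Proof.
have -> : poch (c - a) k = (-1) ^+ k * poch (a + (1 - c - k%:R)) k.
  rewrite (_ : a + _ = 1 - (c - a) - k%:R); last by ring.
  by rewrite poch_reflect mulrA -exprMn mulrNN mulr1 expr1n mul1r.
rewrite -chu_vandermonde mulr_sumr; apply: eq_bigr => m _.
have mk : (m <= k)%N by rewrite -ltnS.
have -> : 1 - c - k%:R = 1 - (c + m%:R) - (k - m)%:R by rewrite natrB //; ring.
rewrite poch_reflect -[in (-1) ^+ k](subnK mk) exprD.
rewrite [in RHS]mulrC -!mulrA; congr (_ * _).
have := sqrr_sign C (k - m); rewrite expr2; move: ((-1) ^+ (k - m)) => u.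
move: (poch (c + _) _) (poch a m) ((-1) ^+ m) => p q v uu.
transitivity ((u * u) * (p * q * v)); last by ring.
by rewrite uu; ring.
Qed.

Lemma bin_ffact_fact l m : (m <= l)%N ->
  'C(l, m)%:R = (l ^_ m)%:R / m`!%:R :> C.
Proof.
move=> ml; apply: (mulIf (fact_neq0 R m)).
by rewrite divfK ?fact_neq0 // -natrM bin_ffact.
Qed.

Lemma bin_poch l m : (m <= l)%N ->
  'C(l, m)%:R = (-1) ^+ m * poch (- l%:R) m / m`!%:R :> C.
Proof.
by move=> ml; rewrite poch_oppn mulrA -expr2 sqrr_sign mul1r bin_ffact_fact.
Qed.

Lemma sign_bin l m : (m <= l)%N ->
  (-1) ^+ m * 'C(l, m)%:R = poch (- l%:R) m / m`!%:R :> C.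
Proof. by move=> ml; rewrite poch_oppn bin_ffact_fact // mulrA. Qed.

Lemma poch_div_gauss m l c : (m <= l)%N -> poch c l != 0 ->
  (poch c m)^-1 = poch (c + m%:R) (l - m) / poch c l.
Proof.
move=> ml; rewrite -{1 3}(subnKC ml) pochD mulf_eq0 negb_or => /andP[c1 c2].
by field; rewrite c1 c2.
Qed.

(** Terms with m < j vanish because (- m)_j does. After a shift of m by j the rest is a Gauss sum of
    length l - j with parameters s + j and c + j. *)
Lemma sum_poch_ffact l j s c : 0 < c -> (j <= l)%N ->
  \sum_(m < l.+1) poch s m * poch (- l%:R) m * poch (- m%:R) j
    / (poch c m * m`!%:R) =
  (-1) ^+ j * poch s j * poch (- l%:R) j * poch (c - s) (l - j) / poch c l.
Proof.
move=> c0 jl; have pc k := poch_neq0 k c0.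
rewrite -(big_mkord xpredT (fun m => poch s m * poch (- l%:R) m *
  poch (- m%:R) j / (poch c m * m`!%:R))) (big_cat_nat (n := j)) //=;
    last first.
  exact: leqW.
rewrite big_nat_cond big1 ?add0r; last first.
  move=> m /andP[/andP[_ mj] _].
  by rewrite [poch (- m%:R) j]poch_oppn ffact_small // !(mulr0, mul0r).
rewrite -{1}[j]add0n big_addn subSn // big_mkord.
have -> : c - s = (c + j%:R) - (s + j%:R) by ring.
rewrite -gauss_sum mulr_sumr mulr_suml; apply: eq_bigr => m _.
have mlj : (m <= l - j)%N by rewrite -ltnS.
have mjl : (m + j <= l)%N by lia.
rewrite invfM (poch_div_gauss mjl (pc l)) [poch (- (m + j)%:R) j]poch_oppn.
have e2 : ((m + j) ^_ j)%:R * m`!%:R = (m + j)`!%:R :> C.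
  by rewrite -natrM -[m in m`!](addnK j) ffact_fact ?leq_addl.
rewrite bin_poch // -e2 subnDA [(l - m - j)%N]subnAC.
have -> : c + (m + j)%:R = c + j%:R + m%:R by ring.
rewrite addnC !pochD natrB //.
have -> : - l%:R + j%:R = - (l%:R - j%:R) :> C by ring.
have mj0 : ((m + j) ^_ j)%:R != 0 :> C.
  by rewrite pnatr_eq0 -lt0n ffact_gt0 leq_addl.
have := sqrr_sign C m; move: ((-1) ^+ m) => v v2.
have := sqrr_sign C j; move: ((-1) ^+ j) => u u2.
rewrite addnC.
transitivity (u * poch s j * poch (- l%:R) j * poch (s + j%:R) m * poch (-
  (l%:R - j%:R)) m * poch (c + j%:R + m%:R) (l - j - m) / (poch c l * m`!%:R)).
  by field; rewrite fact_neq0 pc.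
transitivity (v ^+ 2 * u * poch s j * poch (- l%:R) j * poch (s + j%:R) m *
  poch (- (l%:R - j%:R)) m * poch (c + j%:R + m%:R) (l - j - m) / (poch c l *
    m`!%:R)).
  by rewrite v2 mul1r.
by field; rewrite fact_neq0 pc.
Qed.

(** The lower parameter 1 makes the sum over n a Gauss sum with value (1 - s - m)_l / l!. A
    Vandermonde convolution in - m and 1 - s lets m enter this value only through (- m)_j, so that
    [sum_poch_ffact] evaluates the sum over m. *)
Lemma appellF2_sum l s c : 0 < c ->
  appellF2 l s c 1 = (l`!%:R * poch c l)^-1 *
    \sum_(j < l.+1) 'C(l, j)%:R * ((-1) ^+ j * poch s j * poch (- l%:R) j *
      poch (1 - s) (l - j) * poch (c - s) (l - j)).
Proof.
move=> c0; have pc k := poch_neq0 k c0.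
have inner m : \sum_(n < l.+1) poch (s + m%:R) n * poch (- l%:R) n
    / (n`!%:R * n`!%:R) = poch (1 - (s + m%:R)) l / l`!%:R.
  rewrite -gauss_sum mulr_suml; apply: eq_bigr => n _.
  have nl : (n <= l)%N by rewrite -ltnS.
  have := poch_div_gauss nl (poch_neq0 l ltr01); rewrite !poch1 => h.
  have -> : poch (1 + n%:R) (l - n) = l`!%:R / n`!%:R :> C.
    by rewrite h mulrCA divff ?mulr1 ?fact_neq0.
  transitivity ((-1) ^+ n * 'C(l, n)%:R * (poch (s + m%:R) n / n`!%:R)).
    by rewrite sign_bin //; field; rewrite !fact_neq0.
  by field; rewrite !fact_neq0.
transitivity (\sum_(m < l.+1) \sum_(j < l.+1) 'C(l, j)%:R *
    poch (1 - s) (l - j) / l`!%:R *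
    (poch s m * poch (- l%:R) m * poch (- m%:R) j / (poch c m * m`!%:R))).
  apply: eq_bigr => m _.
  transitivity (poch s m * poch (- l%:R) m / (poch c m * m`!%:R) *
      (poch (1 - (s + m%:R)) l / l`!%:R)).
    rewrite -inner mulr_sumr; apply: eq_bigr => n _.
    by rewrite pochD poch1; field; rewrite !fact_neq0 pc.
  have -> : 1 - (s + m%:R) = - m%:R + (1 - s) by ring.
  rewrite -chu_vandermonde mulr_suml mulr_sumr; apply: eq_bigr => j _.
  by field; rewrite !fact_neq0 pc.
rewrite exchange_big mulr_sumr; apply: eq_bigr => j _ /=.
rewrite -mulr_sumr sum_poch_ffact //; last by rewrite -ltnS.
by field; rewrite !fact_neq0 pc.
Qed.

Lemma limn_series_finite (u : C^nat) l : (forall n, (l < n)%N -> u n = 0) ->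
  limn (series u) = \sum_(n < l.+1) u n.
Proof.
move=> u0; apply/cvg_lim => //.
rewrite -(cvg_shiftn l.+1) /=.
rewrite (_ : (fun n => _) = fun=> \sum_(n < l.+1) u n); first exact: cvg_cst.
apply/funext => n /=; rewrite /series /= addnC -{1}[(l.+1 + n)%N]addn0.
rewrite addn0 (big_cat_nat (n := l.+1)) ?leq_addr //= big_mkord.
rewrite [X in _ + X]big_nat_cond [X in _ + X]big1 ?addr0 //.
by move=> k /andP[/andP[/u0]].
Qed.

(** Reversing the last j factors of (c - s)_l and (1 - s)_l produces the lower parameters 1 - c + s
    - l and s - l; their symbols then cancel term by term. *)
Lemma hyp3F2_sum l s c : 0 < c ->
  (forall m, (m <= l)%N -> poch (1 - c + s - l%:R) m != 0 /\ poch (s - l%:R) m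
    != 0) ->
  poch (c - s) l * poch (1 - s) l *
  hyp3F2 s (- l%:R) (- l%:R) (1 - c + s - l%:R) (s - l%:R) 1 =
  l`!%:R * poch c l * appellF2 l s c 1.
Proof.
move=> c0 nz; have pc k := poch_neq0 k c0.
rewrite appellF2_sum // mulrA divff ?mul1r ?mulf_neq0 ?fact_neq0 //.
rewrite /hyp3F2 /pFq (@limn_series_finite _ l); last first.
  move=> n ln; rewrite /pFq_term !big_cons !big_nil [poch (- l%:R) n]poch_oppn.
  by rewrite ffact_small // !(mulr0, mul0r).
rewrite mulr_sumr; apply: eq_bigr => j _.
have jl : (j <= l)%N by rewrite -ltnS.
have [nz1 nz2] := nz j jl.
rewrite /pFq_term !big_cons !big_nil !mulr1 expr1n mulr1.
have split_poch a : poch a l = (-1) ^+ j * poch a (l - j) * poch (1 - a - l%:R)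
  j.
  rewrite -{1}(subnK jl) pochD.
  have -> : 1 - a - l%:R = 1 - (a + (l - j)%:R) - j%:R by rewrite natrB //;
    ring.
  rewrite poch_reflect; have := sqrr_sign C j; move: ((-1) ^+ j) => u uu.
  transitivity (u ^+ 2 * (poch a (l - j) * poch (a + (l - j)%:R) j));
    last by ring.
  by rewrite uu mul1r.
rewrite [poch (c - s) l]split_poch [poch (1 - s) l]split_poch.
rewrite (_ : 1 - (c - s) - l%:R = 1 - c + s - l%:R); last by ring.
rewrite (_ : 1 - (1 - s) - l%:R = s - l%:R); last by ring.
have sb := sign_bin jl; have := sqrr_sign C j; move: ((-1) ^+ j) sb => u sb uu.
transitivity (u ^+ 2 * (poch (c - s) (l - j) * poch (1 - s) (l - j) * poch s j *
   poch (- l%:R) j) * (poch (- l%:R) j / j`!%:R)).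
  by field; rewrite nz1 nz2 fact_neq0.
by rewrite -sb uu; ring.
Qed.
End Appell.

(** * Mehler's formula *)

Section Mehler.
Variable R : realType.
Local Notation C := R[i].
Implicit Types (a b c s x y : C) (p : {poly C}).

(** The coefficient of z^k in (1 - z)^(- a). *)
Definition binser a (k : nat) : C := poch a k / k`!%:R.

Lemma binser0 a : binser a 0 = 1.
Proof. by rewrite /binser poch0 divr1. Qed.

Lemma binserS a k : k.+1%:R * binser a k.+1 = (a + k%:R) * binser a k.
Proof.
have n0 : 1 + k%:R != 0 :> C by rewrite addrC natr1 pnatr_eq0.
by rewrite /binser pochSr factS natrM; field; rewrite fact_neq0 n0.
Qed.

Lemma binser_oppn N i : binser (- N%:R) i = (-1) ^+ i * 'C(N, i)%:R.
Proof.
have [iN|Ni] := leqP i N; first by rewrite sign_bin.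
by rewrite /binser poch_oppn ffact_small // bin_small // !mulr0 mul0r.
Qed.

(** Coefficient form of (1 - z) (1 - z)^(- a - 1) = (1 - z)^(- a). *)
Lemma binser_step a k : binser (a + 1) k.+1 - binser (a + 1) k = binser a k.+1.
Proof.
have n0 : 1 + k%:R != 0 :> C by rewrite addrC natr1 pnatr_eq0.
rewrite /binser [poch a _]pochSl pochSr factS natrM.
by field; rewrite fact_neq0 n0.
Qed.

(* The coefficient of t^(2 l) in p(t) (1 - t^2)^(- a). *)
Definition even_coef l a p : C :=
  \sum_(q < l.+1) p`_(q.*2) * binser a (l - q).

Lemma even_coef_sum l a n (F : 'I_n -> {poly C}) :
  even_coef l a (\sum_(i < n) F i) = \sum_(i < n) even_coef l a (F i).
Proof.
rewrite exchange_big; apply: eq_bigr => q _ /=.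
by rewrite coef_sum mulr_suml.
Qed.

Lemma even_coefZ l a c p : even_coef l a (c *: p) = c * even_coef l a p.
Proof.
by rewrite /even_coef mulr_sumr; apply: eq_bigr => q _; rewrite coefZ -mulrA.
Qed.

Lemma even_coefXn_odd l a j : odd j -> even_coef l a 'X^j = 0.
Proof.
move=> oj; apply: big1 => q _; rewrite coefXn.
case: eqP => [E|_]; last by rewrite mul0r.
by move: oj; rewrite -E odd_double.
Qed.

Lemma even_coefXn l a q : even_coef l a 'X^(q.*2) =
  if (q <= l)%N then binser a (l - q) else 0.
Proof.
case: leqP => [ql|lq].
  rewrite /even_coef (bigD1 (inord q)) //= inordK ?ltnS // coefXn eqxx mul1r.
  rewrite big1 ?addr0 // => i ineq; rewrite coefXn.
  case: eqP => [/double_inj E|_]; last by rewrite mul0r.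
  by case/eqP: ineq; apply: val_inj; rewrite /= inordK.
apply: big1 => i _; rewrite coefXn; case: eqP => [/double_inj E|_].
  by have := ltn_ord i; rewrite E ltnS leqNgt lq.
by rewrite mul0r.
Qed.

Lemma even_coef_step l a p : even_coef l (a + 1) ((1 - 'X^2) * p) = even_coef l
  a p.
Proof.
rewrite /even_coef.
under eq_bigr do rewrite mulrBl mul1r coefB coefXnM mulrBl.
rewrite sumrB [X in _ - X]big_ord_recl /= mul0r add0r.
rewrite big_ord_recr [in RHS]big_ord_recr /= subnn !binser0 addrAC;
  congr (_ + _).
rewrite -sumrB; apply: eq_bigr => q _; rewrite /bump /= add1n doubleS /= subSS
  subn1.
by rewrite -mulrBr -[(l - q)%N](@subnSK q l) // binser_step.
Qed.

Lemma even_coef_expn l a N p :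
  even_coef l (a + N%:R) ((1 - 'X^2) ^+ N * p) = even_coef l a p.
Proof.
elim: N a p => [|N IH] a p; first by rewrite addr0 expr0 mul1r.
have -> : a + N.+1%:R = (a + 1) + N%:R by ring.
by rewrite exprSr -mulrA IH even_coef_step.
Qed.

Lemma prod_fact_bin k n r : (r <= n)%N -> (n <= k)%N ->
  4 ^+ r * 'C(k, r.*2)%:R * 'C(k - r.*2, n - r)%:R =
  k`!%:R / (n`!%:R * (k - n)`!%:R) * 'C(n, r)%:R * ((k - n) ^_ r)%:R
    / poch (1 / 2) r :> C.
Proof.
move=> rn nk; have h0 : poch (1 / 2) r != 0 :> C.
  by rewrite poch_neq0 // divr_gt0 // ltr0n.
have [rm|mr] := leqP r (k - n); last first.
  rewrite (ffact_small mr) mulr0 mul0r.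
  have [kr|rk] := ltnP k r.*2; first by rewrite (bin_small kr) mulr0 mul0r.
  by rewrite (@bin_small (k - r.*2)) ?mulr0 //; lia.
(* The even factors of (2 r)! give 2^r r!, the odd ones 2^r (1/2)_r. *)
have rr : (2 * r)`!%:R = 4 ^+ r * r`!%:R * poch (1 / 2) r :> C.
  elim: r {rn rm h0} => [|r IH]; first by rewrite poch0 expr0 !mulr1.
  rewrite mulnS !factS !natrM IH exprS pochSr.
  have -> : (2 * r).+2%:R = 2 * (1 + r%:R) :> C by ring.
  have -> : (2 * r).+1%:R = 2 * (1 / 2 + r%:R) :> C by field.
  by rewrite -[r.+1%:R]natr1; ring.
have f (i j : nat) : (j <= i)%N -> 'C(i, j)%:R = i`!%:R / (j`!%:R * (i -
  j)`!%:R) :> C.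
  move=> ji; apply: (canRL (mulfK _)); first by rewrite mulf_neq0 ?fact_neq0.
  by rewrite -!natrM bin_fact.
have -> : ((k - n) ^_ r)%:R = (k - n)`!%:R / (k - n - r)`!%:R :> C.
  by apply: (canRL (mulfK _)); rewrite ?fact_neq0 // -natrM ffact_fact.
rewrite (f k); last lia. 
rewrite (f _ (n - r)%N); last lia. 
rewrite (f n r) // -mul2n rr.
have -> : (k - 2 * r - (n - r) = k - n - r)%N by lia.
have h4 : 4 ^+ r != 0 :> C by rewrite expf_neq0 // pnatr_eq0.
by field; rewrite h0 h4 !fact_neq0.
Qed.

(** The Pfaff-Saalschutz sum with a = - m, b = l + 1/2 and c = 1/2, where m = k - n. The exponent k
    + 1/2 makes c - a - b the integer - (l - m), and the case distinction turns into a falling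
    factorial that vanishes of itself. *)
Lemma mehler_coef l k n : (n <= k)%N ->
  \sum_(r < n.+1) 4 ^+ r * 'C(k, r.*2)%:R * 'C(k - r.*2, n - r)%:R *
    (if (k - r <= l)%N then binser (k%:R + 1 / 2) (l - (k - r)) else 0) =
  binser (1 / 2) l * k`!%:R * (l ^_ (k - n))%:R * (l ^_ n)%:R
    / ((k - n)`!%:R * n`!%:R * (poch (1 / 2) (k - n) * poch (1 / 2) n)).
Proof.
move=> nk; set m := (k - n)%N.
have half_gt0 : 0 < 1 / 2 :> C by rewrite divr_gt0 // ltr0n.
have h0 i := poch_neq0 i half_gt0.
have [ml|lm] := leqP m l; last first.
  rewrite (ffact_small lm) mulr0 !mul0r big1 // => r _.
  case: ifP => [|_]; last by rewrite mulr0.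
  by have := ltn_ord r; rewrite /m in lm *; lia.
transitivity (k`!%:R * poch (1 / 2) l * (-1) ^+ n /
    (n`!%:R * m`!%:R * poch (1 / 2) k * (l - m)`!%:R * poch (1 / 2) n) *
  (poch (1 / 2 - - m%:R) n * poch (1 / 2 - (l%:R + 1 / 2)) n) : C); last first.
  have -> : 1 / 2 - (l%:R + 1 / 2) = - l%:R :> C by ring.
  rewrite opprK poch_oppn.
  have -> : (l ^_ m)%:R = l`!%:R / (l - m)`!%:R :> C.
    by apply: (canRL (mulfK _)); rewrite ?fact_neq0 // -natrM ffact_fact.
  have := sqrr_sign C n; move: ((-1) ^+ n) => u uu.
  have km : poch (1 / 2) k = poch (1 / 2) m * poch (1 / 2 + m%:R) n :> C.
    by rewrite -pochD subnK.
  have := h0 k; rewrite km mulf_eq0 negb_or => /andP[_ hk].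
  rewrite /binser.
  transitivity (u ^+ 2 * k`!%:R * poch (1 / 2) l * (l ^_ n)%:R /
    (n`!%:R * m`!%:R * poch (1 / 2) m * (l - m)`!%:R * poch (1 / 2) n)).
    by field; rewrite hk !h0 !fact_neq0.
  by rewrite uu; field; rewrite !h0 !fact_neq0.
rewrite -pfaff_saalschutz mulr_sumr; apply: eq_bigr => r _.
have rn : (r <= n)%N by rewrite -ltnS.
rewrite prod_fact_bin // -/m.
have -> : 1 / 2 - - m%:R - (l%:R + 1 / 2) = - (l - m)%:R :> C.
  by rewrite (natrB _ ml); ring.
rewrite !poch_oppn.
have -> : (if (k - r <= l)%N then binser (k%:R + 1 / 2) (l - (k - r)) else 0) =
  poch (1 / 2) l * poch (l%:R + 1 / 2) r * ((l - m) ^_ (n - r))%:R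
   / (poch (1 / 2) k * (l - m)`!%:R).
  case: leqP => krl; last by rewrite ffact_small ?mulr0 ?mul0r // /m; lia.
  have -> : ((l - m) ^_ (n - r))%:R = (l - m)`!%:R / (l - (k - r))`!%:R :> C.
    apply: (canRL (mulfK _)); rewrite ?fact_neq0 // -natrM.
    have -> : (l - (k - r) = l - m - (n - r))%N by rewrite /m; lia.
    by rewrite ffact_fact // /m; lia.
  rewrite [_ + 1 / 2]addrC [l%:R + _]addrC -pochD.
  have -> : (l + r = k + (l - (k - r)))%N by lia.
  by rewrite pochD /binser; field; rewrite h0 !fact_neq0.
have -> : poch (1 / 2 + r%:R) (n - r) = poch (1 / 2) n / poch (1 / 2) r :> C.
  by apply: (canRL (mulfK _)); rewrite ?h0 // mulrC -pochD subnKC.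
have -> : (-1) ^+ n = (-1) ^+ (n - r) * (-1) ^+ r :> C by rewrite -exprD subnK.
have := sqrr_sign C r; have := sqrr_sign C (n - r).
move: ((-1) ^+ (n - r)) ((-1) ^+ r) => v u vv uu.
symmetry.
transitivity (u ^+ 2 * v ^+ 2 * (k`!%:R / (n`!%:R * m`!%:R) * 'C(n, r)%:R *
  (m ^_ r)%:R / poch (1 / 2) r *
  (poch (1 / 2) l * poch (l%:R + 1 / 2) r * ((l - m) ^_ (n - r))%:R /
    (poch (1 / 2) k * (l - m)`!%:R)))).
  by field; rewrite !h0 !fact_neq0.
by rewrite uu vv !mul1r.
Qed.

(** The index i of the binomial theorem becomes n = i + r. For n > k - r the binomial coefficient is
    0, which allows a range independent of r at the upper end. *)
Lemma sum_bin_shift k r x y :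
  'C(k, r.*2)%:R * (x + y) ^+ (k - r.*2) * (x * y) ^+ r =
  \sum_(n < k.+1 | (r <= n)%N)
    'C(k, r.*2)%:R * 'C(k - r.*2, n - r)%:R * (x ^+ (k - n) * y ^+ n).
Proof.
have [kr|rk] := ltnP k r.*2.
  by rewrite bin_small // !mul0r big1 // => n _; rewrite !mul0r.
rewrite -(big_mkord (fun n => r <= n)%N (fun n => 'C(k, r.*2)%:R *
  'C(k - r.*2, n - r)%:R * (x ^+ (k - n) * y ^+ n))).
rewrite -(@big_nat_widenl _ _ _ r 0 _ xpredT) //.
have shift (f : nat -> C) :
    \sum_(r <= i < k.+1) f i = \sum_(i < k.+1 - r) f (i + r)%N.
  by rewrite -{1}[r]add0n big_addn big_mkord.
rewrite shift (@sum_ord_widen _ (k - r.*2).+1 _ (fun i => 'C(k, r.*2)%:R *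
  'C(k - r.*2, i + r - r)%:R * (x ^+ (k - (i + r)) * y ^+ (i + r))));
    last 2 first.
- lia.
- by move=> j jlt; rewrite addnK (bin_small jlt) mulr0 mul0r.
rewrite exprDn mulr_sumr mulr_suml; apply: eq_bigr => i _.
have ik : (i <= k - r.*2)%N by rewrite -ltnS.
have -> : (k - (i + r) = k - r.*2 - i + r)%N by lia.
by rewrite addnK !exprD exprMn -mulr_natr; ring.
Qed.

(** Taking j factors - 2 x y t and k - j factors (x^2 + y^2) t^2 gives t^(2 (k - j) + j), an even
    power only for j = 2 r. Collecting the monomials in x^2 and y^2 by [sum_bin_shift], each
    coefficient is a sum over r evaluated by [mehler_coef]. *)
Lemma mehler_power l k x y :
  even_coef l (k%:R + 1 / 2)
    (((x ^+ 2 + y ^+ 2) *: 'X^2 - (2 * (x * y)) *: 'X) ^+ k) =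
  \sum_(n < k.+1) binser (1 / 2) l * k`!%:R * (l ^_ (k - n))%:R * (l ^_ n)%:R
    / ((k - n)`!%:R * n`!%:R * (poch (1 / 2) (k - n) * poch (1 / 2) n))
    * ((x ^+ 2) ^+ (k - n) * (y ^+ 2) ^+ n).
Proof.
set a := k%:R + 1 / 2; pose h j := even_coef l a 'X^((k - j).*2 + j).
pose F j := 'C(k, j)%:R * (x ^+ 2 + y ^+ 2) ^+ (k - j) * (- (2 * (x * y))) ^+ j
  * h j.
have -> : even_coef l a (((x ^+ 2 + y ^+ 2) *: 'X^2 - (2 * (x * y)) *: 'X) ^+
  k) =
    \sum_(j < k.+1) F j.
  rewrite -scaleNr exprDn even_coef_sum.
  apply: eq_bigr => j _.
  rewrite !exprZn -exprM mul2n -scalerAl -scalerAr scalerA -exprD -scaler_nat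
    scalerA.
  by rewrite even_coefZ mulrA.
rewrite sum_ord_even; last 2 first.
- by move=> j oj; rewrite /F /h even_coefXn_odd ?mulr0 // oddD odd_double.
- by move=> j kj; rewrite /F bin_small ?mul0r.
have FE (r : 'I_k.+1) : F r.*2 = \sum_(n < k.+1 | (r <= n)%N)
  'C(k, r.*2)%:R * 'C(k - r.*2, n - r)%:R * ((x ^+ 2) ^+ (k - n) * (y ^+ 2) ^+
    n) *
   (4 ^+ r * (if (k - r <= l)%N then binser a (l - (k - r)) else 0)).
  rewrite -mulr_suml -sum_bin_shift /F.
  have [kr|rk] := ltnP k r.*2; first by rewrite bin_small // !mul0r.
  rewrite /h -doubleD.
  have -> : (k - r.*2 + r = k - r)%N by lia.
  rewrite even_coefXn -mul2n exprM.
  have -> : (- (2 * (x * y))) ^+ 2 = 4 * (x ^+ 2 * y ^+ 2) by ring.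
  by rewrite exprMn; ring.
under eq_bigr do rewrite FE.
rewrite (exchange_big_dep predT) //=; apply: eq_bigr => n _.
have nk : (n <= k)%N by rewrite -ltnS.
rewrite -mehler_coef // mulr_suml.
rewrite [RHS](big_ord_widen_cond k.+1 xpredT (fun r => 4 ^+ r * 'C(k, r.*2)%:R *
  'C(k - r.*2, n - r)%:R * (if (k - r <= l)%N then binser a (l - (k - r)) else
    0)
  * ((x ^+ 2) ^+ (k - n) * (y ^+ 2) ^+ n))) //=.
by apply: eq_big => [r|r _]; [rewrite ltnS|ring].
Qed.

Lemma coef_expn_1BZX c N i : ((1 - c *: 'X) ^+ N)`_i = binser (- N%:R) i * c ^+
  i.
Proof.
have -> : (1 - c *: 'X) ^+ N = \poly_(j < N.+1) ('C(N, j)%:R * (- c) ^+ j).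
  rewrite poly_def -scaleNr exprDn; apply: eq_bigr => j _.
  by rewrite expr1n mul1r exprZn -scaler_nat scalerA.
rewrite coef_poly binser_oppn (exprNn c) ltnS; case: leqP => [_|Ni];
  first by ring.
by rewrite bin_small // mulr0 mul0r.
Qed.

(** A predicate closed under sums, products and [poch], so that the polynomials in s behind the two
    sides of [mehler] need not be written down. *)
Definition poly_fun (F : C -> C) := exists p, forall s, F s = p.[s].

Lemma poly_fun_cst c : poly_fun (fun=> c).
Proof. by exists c%:P => s; rewrite hornerC. Qed.

Lemma poly_fun_id : poly_fun id.
Proof. by exists 'X => s; rewrite hornerX. Qed.

Lemma poly_funD F G : poly_fun F -> poly_fun G -> poly_fun (fun s => F s + G s).
Proof. by move=> [p Fp] [q Gq]; exists (p + q) => s; rewrite hornerD Fp Gq. Qed.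

Lemma poly_funM F G : poly_fun F -> poly_fun G -> poly_fun (fun s => F s * G s).
Proof. by move=> [p Fp] [q Gq]; exists (p * q) => s; rewrite hornerM Fp Gq. Qed.

Lemma poly_fun_sum n (F : 'I_n -> C -> C) : (forall i, poly_fun (F i)) ->
  poly_fun (fun s => \sum_(i < n) F i s).
Proof.
elim: n F => [|n IH] F pF.
  by exists 0 => s; rewrite big_ord0 horner0.
have [q Fq] := pF ord_max; have [p Fp] := IH _ (fun i => pF (widen_ord (leqnSn
  n) i)).
by exists (p + q) => s; rewrite big_ord_recr hornerD -Fp -Fq.
Qed.

Lemma poly_fun_poch F n : poly_fun F -> poly_fun (fun s => poch (F s) n).
Proof.
move=> pF; elim: n => [|n IH].
  by exists 1 => s; rewrite poch0 hornerC.
have [p Hp] := poly_funM IH (poly_funD pF (poly_fun_cst n%:R)).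
by exists p => s; rewrite pochSr.
Qed.

Lemma poly_fun_binser F n : poly_fun F -> poly_fun (fun s => binser (F s) n).
Proof. by move=> pF; apply: poly_funM (poly_fun_cst _);
  exact: poly_fun_poch. Qed.

Lemma poly_fun_ext F G : poly_fun F -> poly_fun G ->
  (forall N : nat, F (- N%:R) = G (- N%:R)) -> forall s, F s = G s.
Proof.
move=> [p Fp] [q Gq] FG s; rewrite Fp Gq; congr _.[s].
apply/eqP; rewrite -subr_eq0; apply: contraT => pq0.
pose rs := [seq - i%:R : C | i <- iota 0 (size (p - q))].
have : (size rs < size (p - q)%R)%N.
  apply: max_poly_roots pq0 _ _.
    apply/allP => _ /mapP[i _ ->].
    by rewrite rootE hornerD hornerN -Fp -Gq FG subrr.
  rewrite map_inj_uniq ?iota_uniq // => i j /oppr_inj /eqP.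
  by rewrite eqr_nat => /eqP.
by rewrite size_map size_iota ltnn.
Qed.

(* Mehler's formula for Hermite polynomials of even index, its homogeneous
   component of degree d in (x^2, y^2) being weighted by (s)_d. Both sides are
   polynomial in s, so it suffices to treat s = - N, where
   (1 - a t)(1 - b t) = (1 - t^2) + (x^2 + y^2) t^2 - 2 x y t
   can be raised to the power N by the binomial theorem. *)
Lemma mehler l s a b x y : a + b = 2 * (x * y) -> a * b = x ^+ 2 + y ^+ 2 - 1 ->
  \sum_(q < l.+1) (\sum_(i < q.*2.+1) (binser s i * a ^+ i) *
      (binser s (q.*2 - i) * b ^+ (q.*2 - i))) * binser (1 / 2 - s) (l - q) =
  \sum_(m < l.+1) \sum_(n < l.+1) poch s (m + n) *
    (binser (1 / 2) l * poch (- l%:R) m * poch (- l%:R) n /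
       (m`!%:R * n`!%:R * (poch (1 / 2) m * poch (1 / 2) n))
     * ((x ^+ 2) ^+ m * (y ^+ 2) ^+ n)).
Proof.
move=> ab_sum ab_prod; move: s; apply: poly_fun_ext.
- apply: poly_fun_sum => q; apply: poly_funM.
    apply: poly_fun_sum => i.
    by apply: poly_funM; apply: poly_funM (poly_fun_cst _);
      apply: poly_fun_binser; exact: poly_fun_id.
  apply: poly_fun_binser; apply: poly_funD; first exact: poly_fun_cst.
  by exists (- 'X) => s; rewrite hornerN hornerX.
- apply: poly_fun_sum => m.
  apply: poly_fun_sum => n.
  apply: poly_funM (poly_fun_cst _); apply: poly_fun_poch; exact: poly_fun_id.
move=> N.
pose Q := (1 - a *: 'X) * (1 - b *: 'X) : {poly C}.
transitivity (even_coef l (N%:R + 1 / 2) (Q ^+ N)).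
  apply: eq_bigr => q _; rewrite opprK [1 / 2 + _]addrC; congr (_ * _).
  rewrite exprMn coefM; apply: eq_bigr => i _.
  by rewrite !coef_expn_1BZX.
have -> : Q = (1 - 'X^2) + ((x ^+ 2 + y ^+ 2) *: 'X^2 - (2 * (x * y)) *: 'X).
  rewrite -ab_sum (_ : x ^+ 2 + y ^+ 2 = a * b + 1);
    last by rewrite ab_prod subrK.
  rewrite /Q -!mul_polyC !rmorphD !rmorphM; ring.
rewrite exprDn even_coef_sum.
pose F n m := (N ^_ (m + n))%:R *
    (binser (1 / 2) l * (l ^_ m)%:R * (l ^_ n)%:R /
       (m`!%:R * n`!%:R * (poch (1 / 2) m * poch (1 / 2) n))
     * ((x ^+ 2) ^+ m * (y ^+ 2) ^+ n)) : C.
transitivity (\sum_(k < N.+1) \sum_(n < k.+1) F n (k - n)%N).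
  apply: eq_bigr => k _; have kN : (k <= N)%N by rewrite -ltnS.
  rewrite -[X in even_coef _ _ X]scaler_nat even_coefZ.
  have -> : N%:R + 1 / 2 = (k%:R + 1 / 2) + (N - k)%:R :> C by rewrite natrB
    //; ring.
  (* The N - k factors 1 - t^2 from the binomial theorem lower the exponent from N + 1/2 to k +
     1/2. *)
  rewrite even_coef_expn mehler_power mulr_sumr; apply: eq_bigr => n _.
  have nk : (n <= k)%N by rewrite -ltnS.
  by rewrite /F (subnK nk) -(bin_ffact N k) natrM; ring.
(* Large enough that the triangle m + n < M contains both the support m + n <= N of [F] and the
   square m, n <= l, outside which [F] vanishes too. *)
pose M := (N.+1 + l.*2.+1)%N.
rewrite -(@sum_ord_widen _ _ M (fun k => \sum_(n < k.+1) F n (k - n)%N));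
  last 2 first.
- exact: leq_addr.
- move=> k Nk; apply: big1 => n _; have nk : (n <= k)%N by rewrite -ltnS.
  by rewrite /F (subnK nk) (ffact_small Nk) mul0r.
rewrite sum_diag (@sum_ord_widen _ l.+1 M (fun i => \sum_(j < M - i) F i j));
  last 2 first.
- by rewrite /M; lia.
- move=> i li; apply: big1 => j _.
  by rewrite /F (ffact_small li) !(mulr0, mul0r).
rewrite exchange_big /=; apply: eq_bigr => n _.
rewrite (@sum_ord_widen _ l.+1 (M - n) (F n)); last 2 first.
- by have := ltn_ord n; rewrite /M; lia.
- by move=> j lj; rewrite /F (ffact_small lj) !(mulr0, mul0r).
apply: eq_bigr => m _; rewrite /F !poch_oppn exprD.
have := sqrr_sign C m; have := sqrr_sign C n.
move: ((-1) ^+ m) ((-1) ^+ n) => u v vv uu.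
have h0 i : poch (1 / 2) i != 0 :> C by rewrite poch_neq0 // divr_gt0 // ltr0n.
symmetry; transitivity (u ^+ 2 * v ^+ 2 * F n m); last by rewrite uu vv /F;
  ring.
by rewrite /F; field; rewrite !h0 !fact_neq0.
Qed.

End Mehler.

(** * Dominated series and Cauchy products *)

Section DominatedSeries.
Variable R : realType.
Local Notation C := R[i].
Local Notation normc := (@Normc.normc R).
Implicit Types (z w : C) (a b : nat -> C) (al be : nat -> R).

Lemma normcE_norm z : (normc z)%:C = `|z|.
Proof. by case: z. Qed.

Lemma normc_ge0 z : 0 <= normc z.
Proof. by case: z => x y; rewrite /Normc.normc sqrtr_ge0. Qed.

Lemma normcD z w : normc (z + w) <= normc z + normc w.
Proof. exact: (@le_normcD R). Qed.

Lemma normcN z : normc (- z) = normc z.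
Proof. exact: (@complex.normcN R). Qed.

Lemma normc_real (x : R) : normc x%:C = `|x|.
Proof. by rewrite /Normc.normc /= expr0n addr0 sqrtr_sqr. Qed.

Lemma normcX z n : normc (z ^+ n) = normc z ^+ n.
Proof.
elim: n => [|n IH]; first by rewrite !expr0 Normc.normc1.
by rewrite !exprS Normc.normcM IH.
Qed.

Lemma normc_sum (I : Type) (r : seq I) (P : pred I) (F : I -> C) :
  normc (\sum_(i <- r | P i) F i) <= \sum_(i <- r | P i) normc (F i).
Proof.
elim/big_rec2: _ => [|i x z _ le_zx]; first by rewrite Normc.normc0.
by rewrite (le_trans (normcD _ _)) // lerD2l.
Qed.

Lemma normc_le_ReIm z : normc z <= `|complex.Re z| + `|complex.Im z|.
Proof.
rewrite [z in normc z](_ : _ = (complex.Re z)%:C + 'i * (complex.Im z)%:C).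
  rewrite (le_trans (normcD _ _)) // Normc.normcM !normc_real lerD2l.
  by rewrite /Normc.normc /= expr0n add0r expr1n sqrtr1 mul1r.
by rewrite -complexE; case: z.
Qed.

Lemma Re_le_normc z : `|complex.Re z| <= normc z.
Proof. by rewrite -lecR normcE_norm normc_ge_Re. Qed.

Lemma Im_le_normc z : `|complex.Im z| <= normc z.
Proof.
case: z => x y; rewrite -sqrtr_sqr /Normc.normc ler_sqrt ?lerDr ?sqr_ge0 //.
by rewrite addr_ge0 ?sqr_ge0.
Qed.

Definition conv (K : pzRingType) (a b : nat -> K) k : K :=
  \sum_(i < k.+1) a i * b (k - i)%N.

Lemma series_conv (K : pzRingType) (a b : nat -> K) n :
  series (conv a b) n = \sum_(i < n) \sum_(j < n - i) a i * b j.
Proof. by rewrite /series /= big_mkord -(sum_diag (fun i j => a i * b j)). Qed.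

(** What a product of partial sums has in excess of the Cauchy product is the corner i, j < n <= i +
    j. For majorants it is nonnegative and tends to 0, and it bounds the corner of the dominated
    series. *)
Lemma series_mul_conv (K : pzRingType) (a b : nat -> K) n :
  series a n * series b n - series (conv a b) n =
  \sum_(i < n) \sum_(n - i <= j < n) a i * b j.
Proof.
rewrite series_conv /series /= !big_mkord mulr_suml -sumrB.
apply: eq_bigr => i _; rewrite -(big_mkord xpredT (fun j => b j)).
rewrite (big_cat_nat (n := (n - i)%N)) ?leq_subr //= mulrDr big_mkord.
by rewrite mulr_sumr addrC addKr mulr_sumr.
Qed.

(** The triangle i + j < n contains the square of side n / 2 and lies in the square of side n. *)
Lemma cvg_series_conv_ge0 al be (S T : R) :
  (forall k, 0 <= al k) -> (forall k, 0 <= be k) ->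
  series al @ \oo --> S -> series be @ \oo --> T ->
  series (conv al be) @ \oo --> S * T.
Proof.
move=> al0 be0 alS beT.
have half_oo : (fun n => n./2) @ \oo --> \oo.
  apply/cvgnyPge => m; exists m.*2 => // n /= mn.
  by rewrite -[m]doubleK half_leq.
apply: (@squeeze_cvgr _ _ _ _ (fun n => series al n./2 * series be n./2)
    (fun n => series al n * series be n)); last 2 first.
- apply: (cvg_comp _ (fun n => series al n * series be n) half_oo).
  exact: cvgM.
- exact: cvgM.
near=> n; apply/andP; split; last first.
  rewrite -subr_ge0 series_mul_conv sumr_ge0 // => i _.
  by rewrite sumr_ge0 // => j _; rewrite mulr_ge0.
rewrite series_conv /series /= !big_mkord mulr_suml.
rewrite (big_ord_widen n (fun i => al i * \sum_(j < n./2) be j)); last first.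
  by rewrite -{2}(odd_double_half n) -addnn; lia.
rewrite big_mkcond /= ler_sum // => i _.
case: ifP => [ilt|_]; last by rewrite sumr_ge0 // => j _; rewrite mulr_ge0.
rewrite mulr_sumr (big_ord_widen (n - i) (fun j => al i * be j)); last first.
  by have := odd_double_half n; rewrite -addnn; lia.
rewrite big_mkcond /= ler_sum // => j _.
by case: ifP => // _; rewrite mulr_ge0.
Unshelve. all: end_near.
Qed.

(* The series of a sums to z at least as fast as its majorant al sums to S: a
   form of domination stable under Cauchy products, and uniform in parameters
   that do not occur in al. *)
Definition dominated a al z (S : R) := [/\ forall k, normc (a k) <= al k,
  series al @ \oo --> S &
  forall n, normc (z - series a n) <= S - series al n].

Lemma dominated_ge0 a al z S : dominated a al z S -> forall k, 0 <= al k.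
Proof. by case=> h _ _ k; apply: le_trans (h k); exact: normc_ge0. Qed.

Lemma normc_series_sub a al m n : (forall k, normc (a k) <= al k) -> (m <= n)%N
  ->
  normc (series a n - series a m) <= series al n - series al m.
Proof.
move=> h mn; rewrite !sub_series_geq //.
by apply: le_trans (normc_sum _ _ _) _; rewrite ler_sum.
Qed.

(** The distance at n is at most the distance at N plus the part of the majorant between n and N;
    letting N grow leaves the tail. Hence convergence without a rate suffices. *)
Lemma dominated_intro a al z S : (forall k, normc (a k) <= al k) ->
  series al @ \oo --> S ->
  (fun n => normc (z - series a n)) @ \oo --> 0 -> dominated a al z S.
Proof.
move=> h alS az; split=> // n.
have bound : (fun N => normc (z - series a N) + (series al N - series al n))
    @ \oo --> 0 + (S - series al n).
  by apply: cvgD => //; apply: cvgB => //; exact: cvg_cst.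
rewrite -[leRHS]add0r; apply: (ler_cvg_to (cvg_cst _) bound).
near=> N.
rewrite (_ : z - series a n = (z - series a N) + (series a N - series a n)).
  rewrite (le_trans (normcD _ _)) // lerD2l normc_series_sub //.
  by near: N; exists n.
by rewrite addrA subrK.
Unshelve. all: end_near.
Qed.

Lemma dominated_conv a al z S b be w T : dominated a al z S -> dominated b be w
  T ->
  dominated (conv a b) (conv al be) (z * w) (S * T).
Proof.
move=> da db; have al0 := dominated_ge0 da; have be0 := dominated_ge0 db.
have [ha alS az] := da; have [hb beT bw] := db.
have convST := cvg_series_conv_ge0 al0 be0 alS beT.
have le_term i j : normc (a i * b j) <= al i * be j.
  by rewrite Normc.normcM ler_pM ?normc_ge0.
apply: dominated_intro => //.
  move=> k; apply: le_trans (normc_sum _ _ _) _.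
  by apply: ler_sum => i _; exact: le_term.
(* One summand for each part of the error: the tail of b, the tail of a, and the corner of
   [series_mul_conv]. *)
pose e n := S * (T - series be n) + (S - series al n) * normc w +
  (series al n * series be n - series (conv al be) n).
apply: (@squeeze_cvgr _ _ _ _ (fun=> 0) e); last 2 first.
- exact: cvg_cst.
- rewrite (_ : 0 = S * (T - T) + (S - S) * normc w + (S * T - S * T));
  last ring.
  apply: cvgD; last by apply: cvgB => //; exact: cvgM.
  apply: cvgD.
    by apply: cvgM; [exact: cvg_cst|apply: cvgB => //; exact: cvg_cst].
  by apply: cvgM; [apply: cvgB => //; exact: cvg_cst|exact: cvg_cst].
apply: nearW => n; rewrite normc_ge0 /=.
have -> : z * w - series (conv a b) n = series a n * (w - series b n) +
    (z - series a n) * w + (series a n * series b n - series (conv a b) n) by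
      ring.
have S_ge : series al n <= S.
  by rewrite -subr_ge0; apply: le_trans (az n); exact: normc_ge0.
have a_le : normc (series a n) <= series al n.
  by apply: le_trans (normc_sum _ _ _) _; rewrite ler_sum.
apply: le_trans (normcD _ _) _; apply: lerD.
  apply: le_trans (normcD _ _) _; rewrite !Normc.normcM; apply: lerD.
    by rewrite ler_pM ?normc_ge0 // (le_trans a_le).
  by rewrite ler_wpM2r ?normc_ge0.
rewrite !series_mul_conv; apply: le_trans (normc_sum _ _ _) _.
apply: ler_sum => i _; apply: le_trans (normc_sum _ _ _) _.
by apply: ler_sum => j _; exact: le_term.
Qed.

Lemma dominatedZ c a al z S : dominated a al z S ->
  dominated (fun k => c * a k) (fun k => normc c * al k) (c * z) (normc c * S).
Proof.
case=> h alS az.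
have seriesZ (K : pzRingType) (x : K) (f : nat -> K) n :
  series (fun k => x * f k) n = x * series f n by rewrite /series /= mulr_sumr.
split=> [k||n].
- by rewrite Normc.normcM ler_wpM2l ?normc_ge0.
- rewrite (_ : series _ = fun n => normc c * series al n).
    by apply: cvgM => //; exact: cvg_cst.
  by apply/funext => n; rewrite seriesZ.
- by rewrite !seriesZ -!mulrBr Normc.normcM ler_wpM2l ?normc_ge0.
Qed.

(** For a power series z and w are the values at opposite arguments, so their mean retains the even
    terms. Pairing consecutive terms of the majorant keeps its sum equal to [S]. *)
Lemma dominated_even a al z w S : dominated a al z S -> dominated (fun k =>
  (-1) ^+ k * a k) al w S ->
  dominated (fun k => a k.*2) (fun k => al k.*2 + al k.*2.+1) ((z + w) / 2) S.
Proof.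
move=> da [_ _ dw]; have al0 := dominated_ge0 da; have [ha alS dz] := da.
have pairs n : series (fun k => al k.*2 + al k.*2.+1) n = series al n.*2.
  rewrite /series /= !big_mkord.
  elim: n => [|n IH]; first by rewrite !big_ord0.
  by rewrite doubleS !big_ord_recr /= IH addrA.
have evens n : series (fun k => a k.*2) n =
    (series a n.*2 + series (fun k => (-1) ^+ k * a k) n.*2) / 2.
  rewrite /series /= !big_mkord -big_split /=.
  elim: n => [|n IH]; first by rewrite !big_ord0 mul0r.
  have s2 : (-1) ^+ n.*2 = 1 :> C by rewrite -mul2n exprM sqrrN !expr1n.
  by rewrite doubleS !big_ord_recr /= IH exprS s2; field.
split=> [k||n].
- by rewrite (le_trans (ha _)) // lerDl.
- rewrite (_ : series _ = series al \o double); last by apply/funext => n;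
  exact: pairs.
  apply: cvg_comp alS; apply/cvgnyPge => m; exists m => // n /= mn.
  by rewrite -addnn (leq_trans mn) // leq_addr.
rewrite evens pairs -mulrBl Normc.normcM opprD addrACA.
rewrite Normc.normcV (_ : normc 2 = 2); last first.
  by rewrite (_ : 2 = 2%:C) ?normc_real ?normr_nat // rmorph_nat.
rewrite ler_pdivrMr // mulrC mulr_natl mulr2n.
by apply: le_trans (normcD _ _) _; rewrite lerD.
Qed.

End DominatedSeries.

(** * The binomial series with complex exponent *)

Section BinomialSeries.
Variable R : realType.
Local Notation C := R[i].
Local Notation normc := (@Normc.normc R).
Implicit Types (s z w : C) (x y r : R).

Definition cexp z : C :=
  (expR (complex.Re z))%:C * (cos (complex.Im z) +i* sin (complex.Im z)).

Lemma cexpD z w : cexp (z + w) = cexp z * cexp w.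
Proof.
case: z w => [a b] [c d]; rewrite /cexp /= expRD cosD sinD.
by apply/eqP; rewrite eq_complex /=; apply/andP; split; apply/eqP; ring.
Qed.

Lemma cexp0 : cexp 0 = 1.
Proof. by rewrite /cexp /= expR0 cos0 sin0 mul1r. Qed.

Lemma cexp_real x : cexp x%:C = (expR x)%:C.
Proof. by rewrite /cexp /= cos0 sin0 mulr1. Qed.

Lemma cpowE x s : 0 < x -> cpow x s = cexp (s * (ln x)%:C).
Proof.
case: s => a b x0; rewrite /cpow /cexp /= /powR gt_eqF //.
by rewrite !mulr0 subr0 add0r.
Qed.

Lemma cpowD x s s' : 0 < x -> cpow x (s + s') = cpow x s * cpow x s'.
Proof. by move=> x0; rewrite !cpowE // mulrDl cexpD. Qed.

Lemma cpowM x y s : 0 < x -> 0 < y -> cpow (x * y) s = cpow x s * cpow y s.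
Proof.
move=> x0 y0; rewrite !cpowE ?mulr_gt0 // lnM ?posrE // rmorphD.
by rewrite mulrDr cexpD.
Qed.

Lemma cpow0 x : 0 < x -> cpow x 0 = 1.
Proof. by move=> x0; rewrite cpowE // mul0r cexp0. Qed.

Lemma cpowN x s : 0 < x -> cpow x s * cpow x (- s) = 1.
Proof. by move=> x0; rewrite -cpowD // subrr cpow0. Qed.

(** The bound is (M + 1)_k / k!, the corresponding coefficient of (1 - r)^(- M - 1). *)
Lemma normc_binser s M k : normc s <= M.+1%:R ->
  normc (binser s k) <= 'C(M + k, k)%:R.
Proof.
move=> sM; elim: k => [|k IH].
  by rewrite binser0 bin0 Normc.normc1.
rewrite -(@ler_pM2l _ k.+1%:R) ?ltr0n //.
have -> : k.+1%:R * normc (binser s k.+1) = normc ((s + k%:R) * binser s k).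
  rewrite -binserS (Normc.normcM k.+1%:R); congr (_ * _).
  by rewrite (_ : k.+1%:R = (k.+1%:R)%:C) ?normc_real ?normr_nat // rmorph_nat.
rewrite -natrM addnS -mul_bin_diag natrM (Normc.normcM (s + k%:R)) ler_pM
  ?normc_ge0 //.
rewrite (le_trans (normcD _ _)) // -addSn natrD lerD //.
by rewrite (_ : k%:R = (k%:R)%:C) ?normc_real ?normr_nat // rmorph_nat.
Qed.

(** The Cauchy product with the geometric series raises M by one, by the hockey-stick identity. *)
Lemma cvg_bin_series M r : 0 <= r < 1 ->
  cvgn (series (fun k => 'C(M + k, k)%:R * r ^+ k)).
Proof.
move=> /andP[r0 r1]; elim: M => [|M IH].
  rewrite (_ : series _ = series (geometric 1 r)).
    by apply/cvg_ex; eexists; apply: cvg_geometric_series; rewrite ger0_norm.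
  by apply/funext => n; apply: eq_bigr => k _; rewrite binn.
have geo : cvgn (series (fun k => r ^+ k)).
  rewrite (_ : series _ = series (geometric 1 r)).
    by apply/cvg_ex; eexists; apply: cvg_geometric_series; rewrite ger0_norm.
  by apply/funext => n; apply: eq_bigr => k _; rewrite /= mul1r.
have c0 k : 0 <= 'C(M + k, k)%:R * r ^+ k by rewrite mulr_ge0 ?exprn_ge0.
have r0k k : 0 <= r ^+ k by rewrite exprn_ge0.
have := cvg_series_conv_ge0 c0 r0k IH geo.
rewrite (_ : conv _ _ = fun k => 'C(M.+1 + k, k)%:R * r ^+ k).
  by move=> h; apply/cvg_ex; eexists; exact: h.
apply/funext => k; rewrite /conv.
transitivity ((\sum_(i < k.+1) 'C(M + i, i)%:R) * r ^+ k).
  rewrite mulr_suml; apply: eq_bigr => i _.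
  by rewrite -mulrA -exprD subnKC // -ltnS.
congr (_ * _); elim: k => [|k IHk]; first by rewrite big_ord1 !bin0.
by rewrite big_ord_recr /= IHk !addSn !addnS [in RHS]binS natrD addrC.
Qed.

Lemma cvgn_pseries_bin (c : R^nat) (D : R) M x :
  (forall k, `|c k| <= D * 'C(M + k, k)%:R) -> `|x| < 1 -> cvgn (pseries c x).
Proof.
move=> cD x1; apply: normed_cvg.
have r : 0 <= `|x| < 1 by rewrite normr_ge0.
have D0 : 0 <= D.
  by have := le_trans (normr_ge0 _) (cD 0); rewrite bin0 mulr1.
apply: (@series_le_cvg _ _ (fun k => D * ('C(M + k, k)%:R * `|x| ^+ k))).
- by move=> k; rewrite normr_ge0.
- by move=> k; rewrite !mulr_ge0 ?exprn_ge0.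
- by move=> k; rewrite /= normrM normrX mulrA ler_wpM2r ?exprn_ge0.
rewrite (_ : series _ = fun n => D * series (fun k => 'C(M + k, k)%:R * `|x| ^+
  k) n).
  apply: is_cvgM; first exact: is_cvg_cst.
  exact: cvg_bin_series.
by apply/funext => n; rewrite /series /= mulr_sumr.
Qed.

Lemma normc_bound s : exists M, normc s <= M.+1%:R.
Proof.
exists (Num.truncn (normc s)).
by apply: ltW; rewrite truncnS_gt.
Qed.

(** The binomial series is split into two real power series, to which termwise differentiation
    applies. *)
Definition reS s x := limn (pseries (fun k => complex.Re (binser s k)) x).
Definition imS s x := limn (pseries (fun k => complex.Im (binser s k)) x).

Lemma cvg_lincomb_pseries (p q : R) s x : `|x| < 1 ->
  pseries (fun k => p * complex.Re (binser s k) + q * complex.Im (binser s k)) x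
    @ \oo --> p * reS s x + q * imS s x.
Proof.
move=> x1; have [M sM] := normc_bound s.
have reC : cvgn (pseries (fun k => complex.Re (binser s k)) x).
  apply: (@cvgn_pseries_bin _ 1 M) => // k; rewrite mul1r.
  exact: le_trans (Re_le_normc _) (normc_binser _ sM).
have imC : cvgn (pseries (fun k => complex.Im (binser s k)) x).
  apply: (@cvgn_pseries_bin _ 1 M) => // k; rewrite mul1r.
  exact: le_trans (Im_le_normc _) (normc_binser _ sM).
rewrite (_ : pseries _ _ = (fun n =>
   p * pseries (fun k => complex.Re (binser s k)) x n +
   q * pseries (fun k => complex.Im (binser s k)) x n)).
  by apply: cvgD; apply: cvgM => //; exact: cvg_cst.
apply/funext => n; rewrite /pseries /series /= !mulr_sumr -big_split.
by apply: eq_bigr => k _ /=; ring.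
Qed.

(** The coefficient identity behind this says that (1 - x)^(- s) has derivative s (1 - x)^(- s - 1).
    The complex factor s mixes real and imaginary parts, so a general real combination of both is
    differentiated at once. *)
Lemma is_derive_lincomb (p q : R) s x : `|x| < 1 ->
  is_derive x 1 (fun x => limn (pseries
    (fun k => p * complex.Re (binser s k) + q * complex.Im (binser s k)) x))
   (p * (complex.Re s * reS (s + 1) x - complex.Im s * imS (s + 1) x)
    + q * (complex.Re s * imS (s + 1) x + complex.Im s * reS (s + 1) x)).
Proof.
move=> x1; set c := fun k => p * _ + q * _.
have diffs p' q' s' : pseries_diffs (fun k => p' * complex.Re (binser s' k) +
    q' * complex.Im (binser s' k)) =
  fun k => (p' * complex.Re s' + q' * complex.Im s') * complex.Re (binser (s' +
    1) k)
   + (q' * complex.Re s' - p' * complex.Im s') * complex.Im (binser (s' + 1) k).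
  apply/funext => k; rewrite /pseries_diffs.
  have : k.+1%:R * binser s' k.+1 = s' * binser (s' + 1) k.
    have n0 : 1 + k%:R != 0 :> C by rewrite addrC natr1 pnatr_eq0.
    rewrite /binser pochSl factS natrM; field.
    by rewrite n0 fact_neq0.
  rewrite (_ : k.+1%:R = (k.+1%:R)%:C); last by rewrite rmorph_nat.
  move: (binser s' k.+1) (binser (s' + 1) k) => [u v] [u' v'];
    case: s' => [a b] /=.
  move/eqP; rewrite eq_complex /= => /andP[/eqP e1 /eqP e2].
  rewrite mul0r subr0 in e1; rewrite mul0r addr0 in e2.
  by rewrite mulrDr [_ * (p' * u)]mulrCA [_ * (q' * v)]mulrCA e1 e2; ring.
have cvgl p' q' s' y : `|y| < 1 -> cvgn (pseries (fun k =>
    p' * complex.Re (binser s' k) + q' * complex.Im (binser s' k)) y).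
  by move=> y1; apply/cvg_ex; eexists; exact: cvg_lincomb_pseries.
(* The midpoint of |x| and 1: a radius beyond |x| at which the series and its derived series still
   converge. *)
pose K := (`|x| + 1) / 2.
have K0 : 0 <= K by rewrite /K divr_ge0 // addr_ge0.
have K1 : `|K| < 1 by rewrite (ger0_norm K0) /K ltr_pdivrMr // mul1r mulr2n
  ltrD2r.
have xK : `|x| < `|K|.
  by rewrite (ger0_norm K0) /K ltr_pdivlMr // mulr_natr mulr2n ltrD2l.
apply: is_derive_eq.
  apply: (@pseries_snd_diffs R c K x _ _ _ xK).
  - exact: cvgl.
  - by rewrite /c diffs; exact: cvgl.
  - by rewrite /c !diffs; exact: cvgl.
rewrite /c diffs (cvg_lim _ (cvg_lincomb_pseries x1)) //.
by ring.
Qed.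

Lemma is_derive_reS s x : `|x| < 1 -> is_derive x 1 (reS s)
  (complex.Re s * reS (s + 1) x - complex.Im s * imS (s + 1) x).
Proof.
move=> x1; have := @is_derive_lincomb 1 0 s x x1.
rewrite !mul1r mul0r addr0; congr (is_derive _ _ _ _).
by apply/funext => y; congr (limn (pseries _ y)); apply/funext => k;
  rewrite mul1r mul0r addr0.
Qed.

Lemma is_derive_imS s x : `|x| < 1 -> is_derive x 1 (imS s)
  (complex.Re s * imS (s + 1) x + complex.Im s * reS (s + 1) x).
Proof.
move=> x1; have := @is_derive_lincomb 0 1 s x x1.
rewrite !mul1r mul0r add0r; congr (is_derive _ _ _ _).
by apply/funext => y; congr (limn (pseries _ y)); apply/funext => k;
  rewrite mul1r mul0r add0r.
Qed.

Lemma pseries_shift (p q : R) s x n :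
  let c s := fun k => p * complex.Re (binser s k) + q * complex.Im (binser s k)
    in
  pseries (c (s + 1)) x n.+1 - x * pseries (c (s + 1)) x n = pseries (c s) x
    n.+1.
Proof.
move=> c; rewrite /pseries /series /= !big_mkord big_ord_recl [in
  RHS]big_ord_recl.
rewrite -addrA mulr_sumr -sumrB /c !binser0; congr (_ + _).
apply: eq_bigr => k _; rewrite /= /bump /= add1n -(binser_step s k).
by rewrite [complex.Re (_ - _)]raddfB [complex.Im (_ - _)]raddfB exprS; ring.
Qed.

Lemma lincomb_shift (p q : R) s x : `|x| < 1 ->
  (1 - x) * (p * reS (s + 1) x + q * imS (s + 1) x) = p * reS s x + q * imS s x.
Proof.
move=> x1; have c1 := @cvg_lincomb_pseries p q (s + 1) x x1.
have c0 := @cvg_lincomb_pseries p q s x x1.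
rewrite mulrBl mul1r; pose c s k := p * complex.Re (binser s k) + q *
  complex.Im (binser s k).
have c2 : (fun n => pseries (c (s + 1)) x n.+1 - x * pseries (c (s + 1)) x n) @
  \oo -->
    p * reS s x + q * imS s x.
  rewrite (_ : (fun n => _) = fun n => pseries (c s) x n.+1);
    first by rewrite cvg_shiftS.
  by apply/funext => n; exact: pseries_shift.
apply: (cvg_unique _ _ c2) => //.
apply: cvgB; first by rewrite cvg_shiftS.
by apply: cvgM => //; exact: cvg_cst.
Qed.

Lemma reS_shift s x : `|x| < 1 -> (1 - x) * reS (s + 1) x = reS s x.
Proof. by move=> x1; have := @lincomb_shift 1 0 s x x1;
  rewrite !mul1r !mul0r !addr0. Qed.

Lemma imS_shift s x : `|x| < 1 -> (1 - x) * imS (s + 1) x = imS s x.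
Proof. by move=> x1; have := @lincomb_shift 0 1 s x x1;
  rewrite !mul1r !mul0r !add0r. Qed.

Lemma derive0_cst_unit_ball (f : R -> R) :
  (forall x, `|x| < 1 -> is_derive x 1 f 0) -> forall z : R, `|z| < 1 -> f z =
    f 0.
Proof.
move=> df z z1.
have cf x : `|x| < 1 -> {for x, continuous f}.
  by move=> /df[dfx dfx0]; exact/differentiable_continuous/derivable1_diffP.
have seg (a b : R) : a <= b -> `|a| < 1 -> `|b| < 1 -> f b = f a.
  move=> ab; rewrite !ltr_norml => /andP[a1 _] /andP[_ b1].
  have inside x : a <= x <= b -> `|x| < 1.
    move=> /andP[ax xb]; rewrite ltr_norml (lt_le_trans a1 ax).
    by rewrite (le_lt_trans xb b1).
  have [||c _] := @MVT_segment R f (fun=> 0) a b ab.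
  - move=> x; rewrite in_itv /= => /andP[ax xb].
    by apply: df; apply: inside; rewrite !ltW.
  - apply: continuous_in_subspaceT => x; rewrite inE /= in_itv /= => abx.
    by apply: cf; exact: inside.
  - by rewrite mul0r => /eqP; rewrite subr_eq0 => /eqP.
have [z0|z0] := leP 0 z; first by apply: seg => //; rewrite normr0.
by symmetry; apply: seg => //; [exact: ltW|rewrite normr0].
Qed.

Lemma limn_pseries0 (c : R^nat) : limn (pseries c 0) = c 0%N.
Proof.
apply/cvg_lim => //; rewrite -cvg_shiftS.
rewrite (_ : (fun n => _) = fun=> c 0%N); first exact: cvg_cst.
apply/funext => n; rewrite /pseries /series /= big_mkord big_ord_recl expr0
  mulr1.
by rewrite big1 ?addr0 // => i _; rewrite expr0n mulr0.
Qed.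

(** The product of the series with (1 - x)^s has derivative 0 and equals 1 at 0. In that derivative
    [reS_shift] and [imS_shift] bring all series to the parameter s + 1, where the terms cancel. *)
Lemma binomial_series_sum s x : `|x| < 1 ->
  reS s x +i* imS s x = cpow (1 - x) (- s).
Proof.
move=> x1; pose p := complex.Re s; pose q := complex.Im s.
pose L (y : R) := ln (1 - y).
(* U + i V is (1 - y)^s. *)
pose U y := expR (p * L y) * cos (q * L y);
  pose V y := expR (p * L y) * sin (q * L y).
have y0 (y : R) : `|y| < 1 -> 0 < 1 - y.
  by rewrite ltr_norml subr_gt0 => /andP[].
have dL y : `|y| < 1 -> is_derive y 1 L (- (1 - y)^-1).
  move=> y1; have d1 : is_derive y 1 (fun y : R => 1 - y) (-1).
    have := @is_deriveB R R R (cst 1) id y 1 0 1 _ _.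
    by rewrite sub0r; apply.
  by have := @is_derive1_comp R (@ln R) (fun y => 1 - y) y _ _ (is_derive1_ln
    (y0 y y1)) d1; rewrite mulrN1.
have dE y : `|y| < 1 ->
    is_derive y 1 (fun y => expR (p * L y)) (expR (p * L y) * (p * - (1 -
      y)^-1)).
  by move=> y1; exact: (@is_derive1_comp R (@expR R) (fun y => p * L y) y _ _ _
    (is_deriveZ p (dL y y1))).
have dU y : `|y| < 1 -> is_derive y 1 U (- (1 - y)^-1 * (p * U y - q * V y)).
  move=> y1; have dc : is_derive y 1 (fun y => cos (q * L y))
      (- sin (q * L y) * (q * - (1 - y)^-1)).
    exact: (@is_derive1_comp R (@cos R) (fun y => q * L y) y _ _ _ (is_deriveZ
      q (dL y y1))).
  apply: is_derive_eq (is_deriveM (dE y y1) dc) _.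
  by rewrite /U /V /GRing.scale /=; ring.
have dV y : `|y| < 1 -> is_derive y 1 V (- (1 - y)^-1 * (p * V y + q * U y)).
  move=> y1; have ds : is_derive y 1 (fun y => sin (q * L y))
      (cos (q * L y) * (q * - (1 - y)^-1)).
    exact: (@is_derive1_comp R (@sin R) (fun y => q * L y) y _ _ _ (is_deriveZ
      q (dL y y1))).
  apply: is_derive_eq (is_deriveM (dE y y1) ds) _.
  by rewrite /U /V /GRing.scale /=; ring.
have UV0 : U 0 = 1 /\ V 0 = 0.
  by rewrite /U /V /L subr0 ln1 !mulr0 expR0 cos0 sin0 mul1r mulr0.
have S0 : reS s 0 = 1 /\ imS s 0 = 0.
  by rewrite /reS /imS !limn_pseries0 binser0.
have HR : reS s x * U x - imS s x * V x = 1.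
  transitivity (reS s 0 * U 0 - imS s 0 * V 0); last first.
    by case: UV0 S0 => -> -> [-> ->]; rewrite !mulr0 subr0 mulr1.
  apply: (@derive0_cst_unit_ball (fun y => reS s y * U y - imS s y * V y)) =>
    // y y1.
  apply: is_derive_eq (is_deriveB (is_deriveM (is_derive_reS s y1) (dU y y1))
    (is_deriveM (is_derive_imS s y1) (dV y y1))) _.
  rewrite -(reS_shift s y1) -(imS_shift s y1) /GRing.scale /= -/p -/q.
  by field; rewrite gt_eqF ?y0.
have HI : reS s x * V x + imS s x * U x = 0.
  transitivity (reS s 0 * V 0 + imS s 0 * U 0); last first.
    by case: UV0 S0 => -> -> [-> ->]; rewrite !mulr0 mul0r addr0.
  apply: (@derive0_cst_unit_ball (fun y => reS s y * V y + imS s y * U y)) =>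
    // y y1.
  apply: is_derive_eq (is_deriveD (is_deriveM (is_derive_reS s y1) (dV y y1))
    (is_deriveM (is_derive_imS s y1) (dU y y1))) _.
  rewrite -(reS_shift s y1) -(imS_shift s y1) /GRing.scale /= -/p -/q.
  by field; rewrite gt_eqF ?y0.
have x0 := y0 x x1.
have cE : cpow (1 - x) s = U x +i* V x.
  have cexp_ln (z : C) (l : R) : cexp (z * l%:C) =
      (expR (complex.Re z * l) * cos (complex.Im z * l)) +i*
      (expR (complex.Re z * l) * sin (complex.Im z * l)).
    by case: z => a b; rewrite /cexp /= !mulr0 subr0 add0r; simpc.
  by rewrite cpowE // cexp_ln.
have e : (reS s x +i* imS s x) * cpow (1 - x) s = 1.
  rewrite cE; apply/eqP; rewrite eq_complex.
  by apply/andP; split; apply/eqP; [exact: HR|exact: HI].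
by rewrite -[LHS]mulr1 -(cpowN s x0) mulrA e mul1r.
Qed.

(** The majorant and its sum depend on M and r alone; all later uniformity in x and y stems from
    this. *)
Lemma dominated_binser s M (z r : R) : normc s <= M.+1%:R -> `|z| <= r -> r < 1
  ->
  dominated (fun k => binser s k * (z%:C) ^+ k) (fun k => 'C(M + k, k)%:R * r
    ^+ k)
   (cpow (1 - z) (- s)) (limn (series (fun k => 'C(M + k, k)%:R * r ^+ k))).
Proof.
move=> sM zr r1; have r0 : 0 <= r by exact: le_trans (normr_ge0 _) zr.
have z1 : `|z| < 1 by exact: le_lt_trans r1.
apply: dominated_intro.
- move=> k; rewrite (Normc.normcM (binser s k)) normcX normc_real.
  by rewrite ler_pM ?normc_ge0 ?exprn_ge0 ?normc_binser // lerXn2r ?nnegrE.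
- by apply: cvg_bin_series; rewrite r0.
rewrite -binomial_series_sum //.
have Re_series n : complex.Re (series (fun k => binser s k * z%:C ^+ k) n) =
    pseries (fun k => complex.Re (binser s k)) z n.
  rewrite /series /pseries /= raddf_sum; apply: eq_bigr => k _ /=.
  by rewrite -rmorphXn; case: (binser s k) => u v /=; rewrite mulr0 subr0.
have Im_series n : complex.Im (series (fun k => binser s k * z%:C ^+ k) n) =
    pseries (fun k => complex.Im (binser s k)) z n.
  rewrite /series /pseries /= raddf_sum; apply: eq_bigr => k _ /=.
  by rewrite -rmorphXn; case: (binser s k) => u v /=; rewrite mulr0 add0r.
have := @cvg_lincomb_pseries 1 0 s z z1.
have := @cvg_lincomb_pseries 0 1 s z z1.
rewrite !mul1r !mul0r add0r addr0.
rewrite (_ : (fun k => _ + 1 * complex.Im _) = fun k => complex.Im (binser s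
  k)); last first.
  by apply/funext => k; rewrite mul0r add0r mul1r.
rewrite (_ : (fun k => 1 * complex.Re _ + _) = fun k => complex.Re (binser s
  k)); last first.
  by apply/funext => k; rewrite mul0r addr0 mul1r.
move=> cI cR.
apply: (@squeeze_cvgr _ _ _ _ (fun=> 0) (fun n =>
  `|reS s z - pseries (fun k => complex.Re (binser s k)) z n| +
  `|imS s z - pseries (fun k => complex.Im (binser s k)) z n|)).
- apply: nearW => n; rewrite normc_ge0 /= -Re_series -Im_series.
  apply: le_trans (normc_le_ReIm _) _.
  by case: (series _ n) => u v.
- exact: cvg_cst.
have dist0 (u : R^nat) l : u @ \oo --> l -> (fun n => `|l - u n|) @ \oo --> 0.
  move=> ul; rewrite -(normr0 R) -(subrr l).
  by apply: cvg_norm; apply: cvgB => //; exact: cvg_cst.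
rewrite -[0]addr0; apply: cvgD; exact: dist0.
Qed.

End BinomialSeries.

(** * Expansion of the powers of Lambda *)

Section LambdaSeries.
Variable R : realType.
Local Notation C := R[i].
Local Notation normc := (@Normc.normc R).
Implicit Types (s z w : C) (x y r alpha : R).

Lemma cosh_gt0 alpha : 0 < cosh alpha.
Proof. by rewrite /cosh divr_gt0 // addr_gt0 ?expR_gt0. Qed.

Lemma cosh2B_sinh2 alpha : cosh alpha ^+ 2 - sinh alpha ^+ 2 = 1.
Proof.
rewrite /cosh /sinh; have := expRxMexpNx_1 alpha.
move: (expR alpha) (expR (- alpha)) => u v uv.
by transitivity (u * v); [field|].
Qed.

Lemma onemtanh2 alpha : 1 - tanh alpha ^+ 2 = (cosh alpha ^+ 2)^-1.
Proof.
have c2 : cosh alpha ^+ 2 != 0 by rewrite expf_neq0 // gt_eqF ?cosh_gt0.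
apply: (mulIf c2); rewrite /tanh expr_div_n mulrBl mul1r divfK // mulVf //.
exact: cosh2B_sinh2.
Qed.

Lemma tanh_lt1 alpha : `|tanh alpha| < 1.
Proof.
rewrite -(@ltr_pXn2r _ 2) ?nnegrE // expr1n real_normK ?num_real //.
by rewrite -subr_gt0 onemtanh2 invr_gt0 exprn_gt0 ?cosh_gt0.
Qed.

Lemma cpow_onemtanh2 alpha s :
  cpow (1 - tanh alpha ^+ 2) (- s) = cpow (cosh alpha) (s + s).
Proof.
have c0 := cosh_gt0 alpha.
rewrite onemtanh2 !cpowE ?invr_gt0 ?exprn_gt0 // lnV ?posrE ?exprn_gt0 // lnXn
  //.
by congr cexp; rewrite rmorphN mulrNN mulr2n rmorphD mulrDr mulrDl.
Qed.

Lemma cpow_cosh1 alpha : cpow (cosh alpha) 1 = (cosh alpha)%:C.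
Proof. by rewrite cpowE ?cosh_gt0 // mul1r cexp_real lnK ?posrE ?cosh_gt0. Qed.

Lemma Lambda_factor alpha x y a b : a + b = 2 * (x * y) ->
  a * b = x ^+ 2 + y ^+ 2 - 1 ->
  (1 - a * tanh alpha) * (1 - b * tanh alpha) =
  Lambda alpha x y * (1 - tanh alpha ^+ 2).
Proof.
move=> ab_sum ab_prod; have c0 : cosh alpha != 0 by rewrite gt_eqF ?cosh_gt0.
have -> : (1 - a * tanh alpha) * (1 - b * tanh alpha) =
    1 - (a + b) * tanh alpha + a * b * tanh alpha ^+ 2 by ring.
rewrite ab_sum ab_prod onemtanh2 /Lambda /tanh.
rewrite (_ : 1 - _ + _ = (cosh alpha ^+ 2 - sinh alpha ^+ 2 + (x ^+ 2 + y ^+ 2)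
  *
  sinh alpha ^+ 2 - 2 * x * y * sinh alpha * cosh alpha) / cosh alpha ^+ 2).
  by rewrite cosh2B_sinh2.
by field.
Qed.

(* With x = cos u and y = cos v these are cos (u - v) and cos (u + v). *)
Lemma cos_add_sub x y : `|x| <= 1 -> `|y| <= 1 ->
  exists a b, [/\ a + b = 2 * (x * y), a * b = x ^+ 2 + y ^+ 2 - 1,
    `|a| <= 1 & `|b| <= 1].
Proof.
move=> x1 y1.
have sq1 (z : R) : `|z| <= 1 -> 0 <= 1 - z ^+ 2.
  by move=> z1; rewrite subr_ge0 -[z ^+ 2]real_normK ?num_real // exprn_ile1.
pose e := Num.sqrt (1 - x ^+ 2); pose f := Num.sqrt (1 - y ^+ 2).
have e2 : e ^+ 2 = 1 - x ^+ 2 by rewrite sqr_sqrtr ?sq1.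
have f2 : f ^+ 2 = 1 - y ^+ 2 by rewrite sqr_sqrtr ?sq1.
exists (x * y + e * f), (x * y - e * f).
(* Here z is the cosine of a difference or sum of two angles and u, up to sign, its sine. *)
have abs1 (z u : R) : 1 - z ^+ 2 = u ^+ 2 -> `|z| <= 1.
  move=> zu; rewrite -(@ler_pXn2r _ 2) ?nnegrE // expr1n real_normK ?num_real
    //.
  by rewrite -subr_ge0 zu sqr_ge0.
split; first by ring.
- rewrite mulrC -subr_sqr exprMn [(e * f) ^+ 2]exprMn e2 f2; ring.
- apply: (abs1 _ (x * f - y * e)).
  transitivity ((x ^+ 2 + e ^+ 2) * (y ^+ 2 + f ^+ 2) - (x * y + e * f) ^+ 2).
    by rewrite e2 f2; ring.
  by ring.
- apply: (abs1 _ (x * f + y * e)).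
  transitivity ((x ^+ 2 + e ^+ 2) * (y ^+ 2 + f ^+ 2) - (x * y - e * f) ^+ 2).
    by rewrite e2 f2; ring.
  by ring.
Qed.

Lemma normc_bound2 s s' : exists M, normc s <= M.+1%:R /\ normc s' <= M.+1%:R.
Proof.
have [M sM] := normc_bound s; have [N sN] := normc_bound s'.
exists (maxn M N); split.
  by rewrite (le_trans sM) // ler_nat ltnS leq_maxl.
by rewrite (le_trans sN) // ler_nat ltnS leq_maxr.
Qed.

Lemma onemM_gt0 alpha (a : R) : `|a| <= 1 -> 0 < 1 - a * tanh alpha.
Proof.
move=> a1; rewrite subr_gt0 (le_lt_trans (ler_norm _)) // normrM.
by rewrite (le_lt_trans _ (tanh_lt1 alpha)) // ler_piMl.
Qed.

Lemma onemtanh2_gt0 alpha : 0 < 1 - tanh alpha ^+ 2.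
Proof. by rewrite onemtanh2 invr_gt0 exprn_gt0 ?cosh_gt0. Qed.

Lemma Lambda_gt0 alpha x y : `|x| <= 1 -> `|y| <= 1 -> 0 < Lambda alpha x y.
Proof.
move=> x1 y1; have [a [b [ab_sum ab_prod a1 b1]]] := cos_add_sub x1 y1.
rewrite -(pmulr_lgt0 _ (onemtanh2_gt0 alpha)) -(Lambda_factor alpha ab_sum
  ab_prod).
by rewrite mulr_gt0 ?onemM_gt0.
Qed.

(** Lambda^(- s) contributes (1 - t^2)^s and cosh alpha contributes (1 - t^2)^(-1/2), which yields
    the exponent 1/2 - s of [mehler]. *)
Lemma cpow_Lambda alpha x y a b s : `|x| <= 1 -> `|y| <= 1 ->
  `|a| <= 1 -> `|b| <= 1 ->
  a + b = 2 * (x * y) -> a * b = x ^+ 2 + y ^+ 2 - 1 ->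
  cpow (Lambda alpha x y) (- s) * (cosh alpha)%:C =
  cpow (1 - a * tanh alpha) (- s) * cpow (1 - b * tanh alpha) (- s)
   * cpow (1 - tanh alpha ^+ 2) (- (1 / 2 - s)).
Proof.
move=> x1 y1 a1 b1 ab_sum ab_prod.
have T0 := onemtanh2_gt0 alpha.
rewrite -cpowM ?onemM_gt0 // (Lambda_factor alpha ab_sum ab_prod).
rewrite cpowM ?Lambda_gt0 // -mulrA; congr (_ * _).
rewrite -cpowD // (_ : - s - (1 / 2 - s) = - (1 / 2)); last by ring.
by rewrite cpow_onemtanh2 -splitr cpow_cosh1.
Qed.

(** The right-hand side of [mehler]: the coefficient of t^(2 l) in cosh alpha Lambda^(- s). *)
Definition mehler_term s (x y : C) l : C :=
  \sum_(m < l.+1) \sum_(n < l.+1) poch s (m + n) *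
    (binser (1 / 2) l * poch (- l%:R) m * poch (- l%:R) n /
       (m`!%:R * n`!%:R * (poch (1 / 2) m * poch (1 / 2) n))
     * ((x ^+ 2) ^+ m * (y ^+ 2) ^+ n)).

(** The order of the quantifiers is the point: the majorant serves all x and y. Changing the sign of
    x changes those of a and b, hence of the odd coefficients, as [dominated_even] expects. *)
Lemma dominated_Lambda s alpha : exists (ga : nat -> R) (S : R), forall x y,
  `|x| <= 1 -> `|y| <= 1 ->
  dominated (fun l => mehler_term s x%:C y%:C l * (tanh alpha)%:C ^+ (2 * l)) ga
   ((cpow (Lambda alpha x y) (- s) + cpow (Lambda alpha (- x) y) (- s)) / 2
    * (cosh alpha)%:C) S.
Proof.
set t := tanh alpha.
have [M [sM sM']] := normc_bound2 s (1 / 2 - s).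
pose al r := fun k => 'C(M + k, k)%:R * r ^+ k : R.
pose A c := fun k => binser s k * ((c * t)%:C) ^+ k.
have dA (c : R) : `|c| <= 1 -> dominated (A c) (al `|t|) (cpow (1 - c * t) (-
  s)) (limn (series (al `|t|))).
  move=> c1; apply: dominated_binser (tanh_lt1 alpha) => //.
  by rewrite normrM ler_piMl.
have t2 : `|t ^+ 2| < 1.
  by rewrite normrX exprn_ilt1 // tanh_lt1.
have dT : dominated (fun k => binser (1 / 2 - s) k * ((t ^+ 2)%:C) ^+ k) (al
  `|t ^+ 2|)
  (cpow (1 - t ^+ 2) (- (1 / 2 - s))) (limn (series (al `|t ^+ 2|))).
  exact: dominated_binser.
(* The majorant is read off from the final Cauchy product; it involves only |t| and t^2, so it may
   be fixed before x and y. *)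
do 2 eexists; move=> x y x1 y1.
have [a [b [ab_sum ab_prod a1 b1]]] := cos_add_sub x1 y1.
have dab := dominated_conv (dA a a1) (dA b b1).
have dNab : dominated (fun k => (-1) ^+ k * conv (A a) (A b) k) (conv (al `|t|)
  (al `|t|))
   (cpow (1 - (- a) * t) (- s) * cpow (1 - (- b) * t) (- s))
   (limn (series (al `|t|)) * limn (series (al `|t|))).
  have := dominated_conv (dA (- a) _) (dA (- b) _).
  rewrite !normrN => /(_ a1 b1); congr dominated; apply/funext => k.
  rewrite /conv mulr_sumr; apply: eq_bigr => i _.
  rewrite /A !mulNr !rmorphN -[- (a * t)%:C]mulN1r -[- (b * t)%:C]mulN1r.
  have ik : (i <= k)%N by rewrite -ltnS.
  have -> : (-1) ^+ k = (-1) ^+ i * (-1) ^+ (k - i) :> C by rewrite -exprD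
    subnKC.
  by rewrite !exprMn; ring.
have dfin := dominated_conv (dominated_even dab dNab) dT.
have := dfin; congr dominated.
- apply/funext => l.
  rewrite /mehler_term -(@mehler _ l s a%:C b%:C x%:C y%:C); last 2 first.
  + by rewrite -rmorphD ab_sum !rmorphM rmorph_nat.
  + by rewrite -rmorphM ab_prod rmorphB rmorphD !rmorphXn rmorph1.
  rewrite [LHS]/conv mulr_suml; apply: eq_bigr => q _.
  have ql : (q <= l)%N by rewrite -ltnS.
  have -> : t%:C ^+ (2 * l) = t%:C ^+ (q.*2) * ((t ^+ 2)%:C) ^+ (l - q).
    rewrite rmorphXn -exprM -exprD; congr (_ ^+ _); lia.
  rewrite [RHS]mulrACA; congr (_ * _); rewrite /conv mulr_suml;
    apply: eq_bigr => i _.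
  have iq : (i <= q.*2)%N by rewrite -ltnS.
  have -> : t%:C ^+ q.*2 = t%:C ^+ i * t%:C ^+ (q.*2 - i) by rewrite -exprD
    subnKC.
  by rewrite /A [(a * t)%:C]rmorphM [(b * t)%:C]rmorphM !exprMn; ring.
- symmetry; rewrite mulrAC mulrDl.
  rewrite (cpow_Lambda alpha s x1 y1 a1 b1 ab_sum ab_prod).
  rewrite (@cpow_Lambda alpha (- x) y (- a) (- b)) ?normrN //.
  + by rewrite -mulrDl mulrAC.
  + by rewrite -opprD ab_sum; ring.
  + by rewrite mulrNN ab_prod sqrrN.
Qed.

Lemma cpow_Lambda_bounded s alpha : exists B : R, forall x y,
  `|x| <= 1 -> `|y| <= 1 -> normc (cpow (Lambda alpha x y) (- s)) <= B.
Proof.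
have [M [sM sM']] := normc_bound2 s (1 / 2 - s).
exists ((cosh alpha)^-1 * (limn (series (fun k => 'C(M + k, k)%:R * `|tanh
  alpha| ^+ k)) *
  limn (series (fun k => 'C(M + k, k)%:R * `|tanh alpha| ^+ k)) *
  limn (series (fun k => 'C(M + k, k)%:R * `|tanh alpha ^+ 2| ^+ k)))) => x y
    x1 y1.
have [a [b [ab_sum ab_prod a1 b1]]] := cos_add_sub x1 y1.
have bound (s' : C) (z r : R) : normc s' <= M.+1%:R -> `|z| <= r -> r < 1 ->
    normc (cpow (1 - z) (- s')) <= limn (series (fun k => 'C(M + k, k)%:R * r
      ^+ k)).
  (* At n = 0 the partial sums are empty, and domination bounds the value itself by the sum of the
     majorant. *)
  move=> h1 h2 h3; have [_ _ /(_ 0%N)] := dominated_binser h1 h2 h3.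
  by rewrite /series /= !big_geq // !subr0.
have c0 := cosh_gt0 alpha.
rewrite ler_pdivlMl //.
have -> : cosh alpha * normc (cpow (Lambda alpha x y) (- s)) =
    normc (cpow (Lambda alpha x y) (- s) * (cosh alpha)%:C).
  by rewrite (Normc.normcM _ (cosh alpha)%:C) normc_real (ger0_norm (ltW c0))
    mulrC.
rewrite (cpow_Lambda alpha s x1 y1 a1 b1 ab_sum ab_prod).
rewrite (Normc.normcM (cpow _ _ * cpow _ _)) (Normc.normcM (cpow _ _) (cpow _
  _)).
have tb (c : R) : `|c| <= 1 -> `|c * tanh alpha| <= `|tanh alpha|.
  by move=> c1; rewrite normrM ler_piMl.
rewrite ler_pM ?mulr_ge0 ?normc_ge0 //; last first.
  by apply: bound => //; rewrite normrX exprn_ilt1 // tanh_lt1.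
by rewrite ler_pM ?normc_ge0 // bound ?tb ?tanh_lt1.
Qed.

End LambdaSeries.

(** * Integration against a probability measure *)

Section BoundedIntegrals.
Context d (T : measurableType d) (R : realType) (mu : probability T R).
Variable D : set T.
Hypotheses (mD : measurable D) (muD : mu D = 1%E).
Local Notation C := R[i].
Local Notation normc := (@Normc.normc R).
Implicit Types (f g : T -> R) (h : T -> C).

(** For a probability measure this class lies in the integrable functions and, unlike them, is
    closed under products. *)
Definition bmeas f :=
  measurable_fun D f /\ exists B : R, forall x, D x -> `|f x| <= B.

Lemma bmeas_integrable f : bmeas f -> mu.-integrable D (EFin \o f).
Proof.
move=> [mf [B fB]]; apply: measurable_bounded_integrable => //.
  by rewrite ltey_eq fin_num_measure.
exists B; split; first exact: num_real.
by move=> y By x Dx /=; exact: le_trans (fB x Dx) (ltW By).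
Qed.

Lemma bmeas_cst c : bmeas (fun=> c).
Proof. by split; [exact: measurable_cst|exists `|c|]. Qed.

Lemma bmeasD f g : bmeas f -> bmeas g -> bmeas (fun x => f x + g x).
Proof.
move=> [mf [B fB]] [mg [B' gB]]; split; first exact: measurable_funD.
by exists (B + B') => x Dx; rewrite (le_trans (ler_normD _ _)) // lerD ?fB ?gB.
Qed.

Lemma bmeasM f g : bmeas f -> bmeas g -> bmeas (fun x => f x * g x).
Proof.
move=> [mf [B fB]] [mg [B' gB]]; split; first exact: measurable_funM.
by exists (B * B') => x Dx; rewrite normrM ler_pM ?fB ?gB.
Qed.

Lemma bmeasX f n : bmeas f -> bmeas (fun x => f x ^+ n).
Proof.
move=> bf; elim: n => [|n IH].
  by rewrite (_ : (fun x => _) = fun=> 1); [exact: bmeas_cst|apply/funext => x;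
    rewrite expr0].
rewrite (_ : (fun x => _) = fun x => f x * f x ^+ n); first exact: bmeasM.
by apply/funext => x; rewrite exprS.
Qed.

Lemma bmeas_sum n (F : 'I_n -> T -> R) : (forall i, bmeas (F i)) ->
  bmeas (fun x => \sum_(i < n) F i x).
Proof.
elim: n F => [|n IH] F bF.
  rewrite (_ : (fun x => _) = fun=> 0); first exact: bmeas_cst.
  by apply/funext => x; rewrite big_ord0.
rewrite (_ : (fun x => _) =
  fun x => \sum_(i < n) F (widen_ord (leqnSn n) i) x + F ord_max x).
  by apply: bmeasD => //; exact: IH.
by apply/funext => x; rewrite big_ord_recr.
Qed.

Lemma Rintegral_sum n (F : 'I_n -> T -> R) : (forall i, bmeas (F i)) ->
  Rintegral mu D (fun x => \sum_(i < n) F i x) = \sum_(i < n) Rintegral mu D (F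
    i).
Proof.
elim: n F => [|n IH] F bF.
  rewrite big_ord0 (_ : (fun x => _) = fun=> 0) ?Rintegral_cst ?mul0r //.
  by apply/funext => x; rewrite big_ord0.
rewrite (_ : (fun x => _) =
  fun x => \sum_(i < n) F (widen_ord (leqnSn n) i) x + F ord_max x); last first.
  by apply/funext => x; rewrite big_ord_recr.
rewrite RintegralD ?big_ord_recr ?IH //; apply: bmeas_integrable => //.
exact: bmeas_sum.
Qed.

Lemma Rintegral_cst1 c : Rintegral mu D (fun=> c) = c.
Proof. by rewrite Rintegral_cst // [X in fine X](_ : _ = 1%E) ?mulr1 // -muD.
  Qed.

Lemma normr_Rintegral_le f B : bmeas f -> (forall x, D x -> `|f x| <= B) ->
  `|Rintegral mu D f| <= B.
Proof.
move=> bf fB; have intf := bmeas_integrable bf.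
apply: le_trans (le_normr_Rintegral _ _) _ => //.
rewrite -[leRHS]Rintegral_cst1; apply: le_Rintegral => //.
  have := integrable_abse intf; congr (_.-integrable _ _).
exact: bmeas_integrable (bmeas_cst _).
Qed.

Definition cbmeas h := bmeas (fun x => complex.Re (h x)) /\ bmeas (fun x =>
  complex.Im (h x)).

Local Notation cint := (cintegral mu D).

Lemma cintegral_real f : cint (fun x => (f x)%:C) = (Rintegral mu D f)%:C.
Proof. by rewrite /cintegral /= Rintegral_cst1. Qed.

Lemma cbmeas_real f : bmeas f -> cbmeas (fun x => (f x)%:C).
Proof. by split=> //; exact: bmeas_cst. Qed.

Lemma cbmeasZ c h : cbmeas h -> cbmeas (fun x => c * h x).
Proof.
move=> [hr hi]; have bc := bmeas_cst; split.
  rewrite (_ : (fun x => _) = fun x => complex.Re c * complex.Re (h x) +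
    (- complex.Im c) * complex.Im (h x)); first by apply: bmeasD; exact: bmeasM.
  by apply/funext => x /=; rewrite mulNr; case: (h x) c => u v [a b].
rewrite (_ : (fun x => _) = fun x => complex.Re c * complex.Im (h x) +
  complex.Im c * complex.Re (h x)); first by apply: bmeasD; exact: bmeasM.
by apply/funext => x /=; case: (h x) c => u v [a b].
Qed.

Lemma cbmeasD h h' : cbmeas h -> cbmeas h' -> cbmeas (fun x => h x + h' x).
Proof.
move=> [hr hi] [hr' hi']; split.
  rewrite (_ : (fun x => _) = fun x => complex.Re (h x) + complex.Re (h' x)).
    exact: bmeasD.
  by apply/funext => x /=; rewrite raddfD.
rewrite (_ : (fun x => _) = fun x => complex.Im (h x) + complex.Im (h' x)).
  exact: bmeasD.
by apply/funext => x /=; rewrite raddfD.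
Qed.

Lemma cintegralZ c h : cbmeas h -> cint (fun x => c * h x) = c * cint h.
Proof.
move=> [hr hi]; have bc := bmeas_cst; rewrite /cintegral.
rewrite (_ : (fun x => complex.Re (c * h x)) = fun x =>
  complex.Re c * complex.Re (h x) + (- complex.Im c) * complex.Im (h x));
    last first.
  by apply/funext => x /=; rewrite mulNr; case: (h x) c => u v [a b].
rewrite (_ : (fun x => complex.Im (c * h x)) = fun x =>
  complex.Re c * complex.Im (h x) + complex.Im c * complex.Re (h x));
    last first.
  by apply/funext => x /=; case: (h x) c => u v [a b].
rewrite !RintegralD //; do ?[by apply: bmeas_integrable; exact: bmeasM].
rewrite !RintegralZl //; do ?[exact: bmeas_integrable].
case: c => a b; apply/eqP; rewrite eq_complex /=.
by apply/andP; split; apply/eqP; ring.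
Qed.

Lemma cintegralD h h' : cbmeas h -> cbmeas h' ->
  cint (fun x => h x + h' x) = cint h + cint h'.
Proof.
move=> [hr hi] [hr' hi']; rewrite /cintegral.
rewrite (_ : (fun x => complex.Re _) = fun x => complex.Re (h x) + complex.Re
  (h' x)); last first.
  by apply/funext => x /=; rewrite raddfD.
rewrite (_ : (fun x => complex.Im _) = fun x => complex.Im (h x) + complex.Im
  (h' x)); last first.
  by apply/funext => x /=; rewrite raddfD.
by rewrite !RintegralD //; exact: bmeas_integrable.
Qed.

Lemma cbmeas_sum n (F : 'I_n -> T -> C) : (forall i, cbmeas (F i)) ->
  cbmeas (fun x => \sum_(i < n) F i x).
Proof.
elim: n F => [|n IH] F bF.
  rewrite (_ : (fun x => _) = fun=> 0%:C);
    first exact: cbmeas_real (bmeas_cst _).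
  by apply/funext => x; rewrite big_ord0.
rewrite (_ : (fun x => _) =
  fun x => \sum_(i < n) F (widen_ord (leqnSn n) i) x + F ord_max x).
  by apply: cbmeasD => //; exact: IH.
by apply/funext => x; rewrite big_ord_recr.
Qed.

Lemma cintegral_sum n (F : 'I_n -> T -> C) : (forall i, cbmeas (F i)) ->
  cint (fun x => \sum_(i < n) F i x) = \sum_(i < n) cint (F i).
Proof.
elim: n F => [|n IH] F bF.
  rewrite big_ord0 (_ : (fun x => _) = fun=> 0%:C) ?cintegral_real
    ?Rintegral_cst1 //.
  by apply/funext => x; rewrite big_ord0.
rewrite (_ : (fun x => _) =
  fun x => \sum_(i < n) F (widen_ord (leqnSn n) i) x + F ord_max x); last first.
  by apply/funext => x; rewrite big_ord_recr.
by rewrite cintegralD ?big_ord_recr ?IH //; exact: cbmeas_sum.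
Qed.

Lemma eq_cintegral h h' : (forall x, D x -> h x = h' x) -> cint h = cint h'.
Proof.
move=> hh'; rewrite /cintegral; congr (_ +i* _); apply: eq_Rintegral => x;
  by rewrite inE => /hh' ->.
Qed.

(** Makes the inner integral an admissible integrand for the outer one. *)
Lemma bmeas_unif_lim f (fn : nat -> T -> R) (e : R^nat) :
  (forall n, bmeas (fn n)) -> (forall n x, D x -> `|f x - fn n x| <= e n) ->
  e @ \oo --> 0 -> bmeas f.
Proof.
move=> bfn fe e0; split.
  apply: (measurable_fun_cvg (fun n => (bfn n).1)) => x Dx.
  apply/cvgrPdist_le => eps eps0.
  have /cvgrPdist_le/(_ eps eps0) := e0; apply: filterS => n.
  rewrite sub0r normrN => /(le_trans (ler_norm _)).
  exact: le_trans (fe n x Dx).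
have [_ [B fB]] := bfn 0%N; exists (e 0%N + B) => x Dx.
rewrite -[f x](subrK (fn 0%N x)) (le_trans (ler_normD _ _)) //.
by rewrite lerD ?fe ?fB.
Qed.

Lemma normr_RintegralB_le f g e : bmeas f -> bmeas g ->
  (forall x, D x -> `|f x - g x| <= e) ->
  `|Rintegral mu D f - Rintegral mu D g| <= e.
Proof.
move=> bf bg fg; rewrite -RintegralB //; do ?[exact: bmeas_integrable].
apply: normr_Rintegral_le => //.
rewrite (_ : (fun x => _) = fun x => f x + (-1) * g x); last first.
  by apply/funext => x; rewrite mulN1r.
by apply: bmeasD => //; apply: bmeasM => //; exact: bmeas_cst.
Qed.

Lemma cbmeas_unif_lim h (hn : nat -> T -> C) (e : R^nat) :
  (forall n, cbmeas (hn n)) -> (forall n x, D x -> normc (h x - hn n x) <= e n)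
    ->
  e @ \oo --> 0 -> cbmeas h.
Proof.
move=> bhn he e0; split.
  apply: (bmeas_unif_lim (fun n => (bhn n).1) _ e0) => n x /(he n).
  by apply: le_trans; rewrite /= -raddfB; exact: Re_le_normc.
apply: (bmeas_unif_lim (fun n => (bhn n).2) _ e0) => n x /(he n).
by apply: le_trans; rewrite /= -raddfB; exact: Im_le_normc.
Qed.

(** The bound is doubled because real and imaginary parts are estimated separately. *)
Lemma normc_cintegralB_le h h' e : cbmeas h -> cbmeas h' ->
  (forall x, D x -> normc (h x - h' x) <= e) ->
  normc (cint h - cint h') <= e + e.
Proof.
move=> [hr hi] [hr' hi'] he; apply: le_trans (normc_le_ReIm _) _.
apply: lerD.
  apply: (normr_RintegralB_le hr hr') => x /he; apply: le_trans.
  by rewrite /= -raddfB; exact: Re_le_normc.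
apply: (normr_RintegralB_le hi hi') => x /he; apply: le_trans.
by rewrite /= -raddfB; exact: Im_le_normc.
Qed.

End BoundedIntegrals.

(** * Moments of the invariant measure on the sphere *)

Section SphereMoments.
Variables (R : realType) (n : nat) (mu : probability (n.-tuple R) R).
Hypothesis mu_unif : uniform_on_sphere mu.
Local Notation D := (@sphere R n).
Local Notation C := R[i].

Lemma measurable_coord (i : 'I_n) (E : set (n.-tuple R)) :
  measurable_fun E (fun x : n.-tuple R => tnth x i).
Proof. by apply: measurable_funTS; apply: measurable_tnth. Qed.

Lemma measurable_sphere : measurable D.
Proof.
have mf : measurable_fun setT (fun x : n.-tuple R => \sum_(i < n) tnth x i ^+
  2).
  by apply: measurable_sum => i; apply: measurable_funX;
    exact: measurable_coord.
have := mf measurableT [set 1] (measurable_set1 _).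
by rewrite setTI; congr measurable; apply/seteqP; split.
Qed.

Lemma sphere_mass : mu D = 1%E. Proof. by case: mu_unif. Qed.

Lemma sphere_coord_le1 (x : n.-tuple R) (i : 'I_n) : D x -> `|tnth x i| <= 1.
Proof.
rewrite /sphere /= => Dx.
rewrite -(@ler_pXn2r _ 2) ?nnegrE // expr1n real_normK ?num_real // -Dx.
by rewrite (bigD1 i) //= lerDl sumr_ge0 // => j _; rewrite sqr_ge0.
Qed.

Lemma bmeas_coord (i : 'I_n) : bmeas D (fun x : n.-tuple R => tnth x i).
Proof.
by split; [exact: measurable_coord|exists 1 => x; exact: sphere_coord_le1].
Qed.

Lemma measurable_mxact (A : 'M[R]_n) : measurable_fun setT (@mxact R n A).
Proof.
apply/measurable_fun_tnthP => i.
rewrite (_ : _ \o _ = fun x : n.-tuple R => \sum_(j < n) A i j * tnth x j).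
  apply: measurable_sum => j.
  by apply: measurable_funM; [exact: measurable_cst|exact: measurable_coord].
by apply/funext => x; rewrite /= tnth_mktuple.
Qed.

Lemma mxact_sphere (A : 'M[R]_n) : A *m A^T = 1%:M -> mxact A @^-1` D = D.
Proof.
move=> AAt; have AtA : A^T *m A = 1%:M by apply: mulmx1C.
have norm2 (x : n.-tuple R) : \sum_i tnth (mxact A x) i ^+ 2 = \sum_i tnth x i
  ^+ 2.
  pose v := \col_j tnth x j.
  have quad (w : 'cV[R]_n) : (w^T *m w) 0 0 = \sum_i w i 0 ^+ 2.
    by rewrite mxE; apply: eq_bigr => i _; rewrite mxE expr2.
  transitivity (((A *m v)^T *m (A *m v)) 0 0).
    rewrite quad; apply: eq_bigr => i _; rewrite tnth_mktuple mxE.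
    by congr (_ ^+ 2); apply: eq_bigr => j _; rewrite mxE.
  rewrite trmx_mul mulmxA -[_ *m _ *m A]mulmxA AtA mulmx1 quad.
  by apply: eq_bigr => i _; rewrite mxE.
by apply/seteqP; split=> x; rewrite /sphere /= norm2.
Qed.

Lemma Rintegral_mxact (A : 'M[R]_n) (f : n.-tuple R -> R) : A *m A^T = 1%:M ->
  measurable_fun setT f -> bmeas D f ->
  Rintegral mu D (f \o mxact A) = Rintegral mu D f.
Proof.
move=> AAt mf bf; have [_ inv] := mu_unif; have mD := measurable_sphere.
have bfA : bmeas D (f \o mxact A).
  split; first by apply: measurable_funTS;
    exact: measurableT_comp (measurable_mxact A).
  have [_ [B fB]] := bf; exists B => x Dx; apply: fB.
  by rewrite -(mxact_sphere AAt) in Dx.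
rewrite /Rintegral; congr fine.
transitivity (\int[pushforward mu (mxact A)]_(x in D) (f x)%:E)%E; last first.
  by apply: eq_measure_integral => [|mphi E mE _];
    [exact: measurable_mxact|exact: inv].
rewrite integral_pushforward //.
- by rewrite (mxact_sphere AAt).
- exact: measurable_mxact.
- exact/measurable_EFinP.
- by rewrite (mxact_sphere AAt); apply: bmeas_integrable.
Qed.

Definition householder (v : 'rV[R]_n) : 'M[R]_n :=
  1%:M - (2 / (v *m v^T) 0 0) *: (v^T *m v).

Lemma householder_ortho v : (v *m v^T) 0 0 != 0 ->
  householder v *m (householder v)^T = 1%:M.
Proof.
set q := (v *m v^T) 0 0 => q0; rewrite /householder -/q.
set a := 2 / q; set P := v^T *m v.
have Pt : P^T = P by rewrite /P trmx_mul trmxK.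
have PP : P *m P = q *: P.
  rewrite /P mulmxA -[v^T *m v *m v^T]mulmxA [v *m v^T]mx11_scalar -/q.
  by rewrite mul_mx_scalar -scalemxAl.
have aq : a * q = 2 by rewrite divfK.
clearbody P a q.
have -> : (1%:M - a *: P)^T = 1%:M - a *: P.
  by apply/matrixP => i j; rewrite !mxE -{2}Pt mxE eq_sym.
rewrite mulmxBl mul1mx mulmxBr mulmx1 -scalemxAl -scalemxAr PP !scalerA -mulrA
  aq.
rewrite opprB addrA -[RHS]addr0 -!addrA; congr (_ + _).
rewrite addrCA -!scaleNr -!scalerDl.
by rewrite (_ : _ + _ = 0) ?scale0r //; ring.
Qed.

Lemma householder_coord v (x : n.-tuple R) i :
  tnth (mxact (householder v) x) i =
  tnth x i - 2 / (v *m v^T) 0 0 * v 0 i * \sum_j v 0 j * tnth x j.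
Proof.
rewrite tnth_mktuple /householder; set a := 2 / _.
transitivity (\sum_j ((i == j)%:R * tnth x j - a * v 0 i * (v 0 j * tnth x j))).
  apply: eq_bigr => j _; rewrite !mxE big_ord1 !mxE; ring.
rewrite sumrB -mulr_sumr; congr (_ - _).
rewrite (bigD1 i) //= eqxx mul1r big1 ?addr0 // => j ji.
by rewrite eq_sym (negPf ji) mul0r.
Qed.

Lemma delta_norm (i : 'I_n) (w : R) (k : 'I_n) (u : R) : i != k ->
  let v := u *: delta_mx 0 i + w *: delta_mx 0 k : 'rV[R]_n in
  (v *m v^T) 0 0 = u ^+ 2 + w ^+ 2 /\ forall F : 'I_n -> R,
    \sum_j v 0 j * F j = u * F i + w * F k.
Proof.
move=> ik v.
have sumv (F : 'I_n -> R) : \sum_j v 0 j * F j = u * F i + w * F k.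
  rewrite (bigD1 i) //= (bigD1 k) 1?eq_sym //= big1 ?addr0.
    by rewrite !mxE !eqxx (negPf ik) [k == i]eq_sym (negPf ik) /= !mulr1 !mulr0
      addr0 add0r.
  by move=> j /andP[ji jk]; rewrite !mxE (negPf ji) (negPf jk) /= !mulr0 addr0
    mul0r.
split=> //; rewrite mxE.
under eq_bigr do rewrite [X in _ * X]mxE.
rewrite (sumv (fun j => v 0 j)) !mxE !eqxx (negPf ik) [k == i]eq_sym (negPf ik)
  /=.
by rewrite !mulr1 !mulr0 addr0 add0r.
Qed.

(** Invariance under the reflection orthogonal to e_i, which exists also for n = 1. *)
Lemma Rintegral_reflect (i : 'I_n) (f : R -> R) : measurable_fun setT f ->
  bmeas D (fun x : n.-tuple R => f (tnth x i)) ->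
  Rintegral mu D (fun x : n.-tuple R => f (- tnth x i)) =
  Rintegral mu D (fun x : n.-tuple R => f (tnth x i)).
Proof.
move=> mf bf; pose v : 'rV[R]_n := delta_mx 0 i.
have q1 : (v *m v^T) 0 0 = 1.
  by rewrite /v trmx_delta mul_delta_mx mxE !eqxx.
have ortho := @householder_ortho v; rewrite q1 in ortho.
have := @Rintegral_mxact (householder v) (fun x => f (tnth x i)) (ortho
  (oner_neq0 _)).
move=> <- //; last by apply: measurableT_comp => //; exact: measurable_coord.
congr Rintegral; apply/funext => x /=; congr f.
rewrite householder_coord q1 !mxE !eqxx mulr1 divr1.
rewrite (bigD1 i) //= big1 ?addr0 => [|j ji].
  by rewrite mxE !eqxx /=; ring.
by rewrite mxE (negPf ji) andbF mul0r.
Qed.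

Definition moment (i : 'I_n) j := Rintegral mu D (fun x : n.-tuple R => tnth x
  i ^+ (2 * j)).

Lemma coef_expn_quad (c : R) N :
  ((1 + c *: 'X^2) ^+ N)`_0 = 1 /\ ((1 + c *: 'X^2) ^+ N)`_1 = 0 /\
  ((1 + c *: 'X^2) ^+ N)`_2 = c * N%:R.
Proof.
elim: N => [|N [IH0 [IH1 IH2]]]; first by rewrite expr0 !coef1 mulr0.
rewrite exprSr mulrDr mulr1 -scalerAr !coefD !coefZ !coefMXn /= IH0 IH1 IH2.
by rewrite !mulr0 !addr0 -natr1; split=> //; split=> //; ring.
Qed.

(* The second-order term in u of the invariance under the reflection in the
   hyperplane orthogonal to u e_i + e_k. *)
Lemma moment_mixed (i k : 'I_n) j : i != k ->
  (2 * j).+1%:R * Rintegral mu D (fun x : n.-tuple R => tnth x i ^+ (2 * j) *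
    tnth x k ^+ 2)
  = moment i j.+1.
Proof.
move=> ik; have mD := measurable_sphere.
pose N := (2 * j.+1)%N.
pose m r := Rintegral mu D (fun x : n.-tuple R => tnth x i ^+ (N - r) * tnth x
  k ^+ r).
have bm r s : bmeas D (fun x : n.-tuple R => tnth x i ^+ r * tnth x k ^+ s).
  by apply: bmeasM; apply: bmeasX; exact: bmeas_coord.
have mN : measurable_fun setT (fun x : n.-tuple R => tnth x i ^+ N).
  by apply: measurable_funX; exact: measurable_coord.
have bN : bmeas D (fun x : n.-tuple R => tnth x i ^+ N).
  by apply: bmeasX; exact: bmeas_coord.
(* The reflection sends x_i to ((1 - u^2) x_i - 2 u x_k) / (1 + u^2). [P] and [Q] are the two sides
   of the invariance of the N-th moment, multiplied by (1 + u^2)^N. *)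
pose P : {poly R} := \sum_(r < N.+1)
  ('C(N, r)%:R * m r) *: ((1 + (-1) *: 'X^2) ^+ (N - r) * ((-2) *: 'X) ^+ r).
pose Q : {poly R} := moment i j.+1 *: (1 + 1 *: 'X^2) ^+ N.
have PQ u : P.[u] = Q.[u].
  have := delta_norm 1 u ik; set v := _ + _; move=> [q_val sumv].
  have q0 : 1 + u ^+ 2 != 0 by rewrite gt_eqF // ltr_wpDr ?sqr_ge0.
  have q0' : u ^+ 2 + 1 ^+ 2 != 0 by rewrite expr1n addrC.
  have coord x : tnth (mxact (householder v) x) i =
      ((1 - u ^+ 2) * tnth x i + (-2 * u) * tnth x k) / (1 + u ^+ 2).
    rewrite householder_coord q_val sumv !mxE !eqxx (negPf ik) /= mulr1 mulr0
      addr0.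
    by rewrite expr1n [u ^+ 2 + 1]addrC; field; exact: q0.
  have := @Rintegral_mxact (householder v) (fun x => tnth x i ^+ N).
  rewrite householder_ortho ?q_val // => /(_ erefl).
  move=> /(_ mN bN) inv.
  rewrite /Q hornerZ horner_exp hornerD hornerC hornerZ hornerXn mul1r /moment
    -inv.
  rewrite -RintegralZr //; last first.
    apply: bmeas_integrable => //=.
    rewrite (_ : (fun x => _) = fun x : n.-tuple R => \sum_(r < N.+1)
       ('C(N, r)%:R * ((1 - u ^+ 2) ^+ (N - r) * (-2 * u) ^+ r / (1 + u ^+ 2)
         ^+ N)) *
       (tnth x i ^+ (N - r) * tnth x k ^+ r)).
      by apply: bmeas_sum => r; apply: bmeasM => //; exact: bmeas_cst.
    apply/funext => x; rewrite coord expr_div_n exprDn mulr_suml;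
      apply: eq_bigr => r _.
    by rewrite -mulr_natl !exprMn; ring.
  rewrite (_ : (fun x => _) = fun x : n.-tuple R => \sum_(r < N.+1)
       ('C(N, r)%:R * ((1 - u ^+ 2) ^+ (N - r) * (-2 * u) ^+ r)) *
       (tnth x i ^+ (N - r) * tnth x k ^+ r)); last first.
    apply/funext => x; rewrite /= coord expr_div_n divfK ?expf_neq0 // exprDn.
    by apply: eq_bigr => r _; rewrite -mulr_natl !exprMn; ring.
  rewrite Rintegral_sum //; last first.
    by move=> r; apply: bmeasM => //; exact: bmeas_cst.
  rewrite /P horner_sum; apply: eq_bigr => r _.
  rewrite RintegralZl //; last exact: bmeas_integrable.
  rewrite hornerZ hornerM !horner_exp hornerD hornerC !hornerZ hornerXn hornerX
    mulN1r.
  by rewrite -/(m r); ring.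
have : P = Q.
  apply/eqP; rewrite -subr_eq0; apply: contraT => pq0.
  pose rs := [seq i%:R : R | i <- iota 0 (size (P - Q))].
  have : (size rs < size (P - Q)%R)%N.
    apply: max_poly_roots pq0 _ _.
      by apply/allP => _ /mapP[l _ ->]; rewrite rootE hornerD hornerN PQ subrr.
    rewrite map_inj_uniq ?iota_uniq // => a b /eqP.
    by rewrite eqr_nat => /eqP.
  by rewrite size_map size_iota ltnn.
(* With e the mixed moment and M the pure one, the coefficients of u^2 give - N M + 4 'C(N, 2) e = N
   M, hence (N - 1) e = M, where N - 1 = 2 j + 1. *)
move=> /(congr1 (fun p : {poly R} => p`_2)).
rewrite /Q coefZ; have [_ [_ ->]] := coef_expn_quad 1 N.
rewrite /P coef_sum.
have term (r : nat) : (('C(N, r)%:R * m r) *: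
    ((1 + (-1) *: 'X^2) ^+ (N - r) * ((-2) *: 'X) ^+ r))`_2 =
  'C(N, r)%:R * m r * (-2) ^+ r *
   (if (2 < r)%N then 0 else ((1 + (-1) *: 'X^2) ^+ (N - r))`_(2 - r)).
  by rewrite coefZ exprZn -scalerAr coefZ coefMXn mulrA.
pose G r := 'C(N, r)%:R * m r * (-2) ^+ r *
   (if (2 < r)%N then 0 else ((1 + (-1) *: 'X^2) ^+ (N - r))`_(2 - r)).
under eq_bigr do rewrite term -/(G _).
have N2 : N = (2 * j).+2 by rewrite /N mulnS.
have -> : \sum_(r < N.+1) G r = G 0%N + G 1%N + G 2.
  rewrite N2 !big_ord_recl big1; first by rewrite addr0 !addrA.
  by move=> r _; rewrite /G mulr0.
rewrite /G N2 /= subn0 subSS subn0 !subSS !subn0 bin0 bin1.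
have [c0 [c1 c2]] := coef_expn_quad (-1) (2 * j).+2.
have [_ [c1' _]] := coef_expn_quad (-1) (2 * j).+1.
have [c0'' _] := coef_expn_quad (-1) (2 * j).
rewrite c2 c1' c0''.
have -> : m 0%N = moment i j.+1.
  by congr Rintegral; apply/funext => x; rewrite expr0 mulr1 subn0.
have -> : m 2 = Rintegral mu D (fun x : n.-tuple R => tnth x i ^+ (2 * j) *
  tnth x k ^+ 2).
  by congr Rintegral; apply/funext => x; rewrite N2 !subSS subn0.
have binE : 2 * 'C((2 * j).+2, 2)%:R = (2 * j).+2%:R * (2 * j).+1%:R :> R.
  by rewrite -!natrM; congr (_%:R); have := mul_bin_diag (2 * j).+2 1;
    rewrite bin1 => ->.
move: (Rintegral _ _ _) (moment _ _) binE => e M binE /eqP.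
rewrite -subr_eq0 expr2 => /eqP E.
have n0 : (2 * j).+2%:R != 0 :> R by rewrite pnatr_eq0.
apply: (mulfI n0); apply/eqP; rewrite -subr_eq0; apply/eqP.
rewrite mulrA -binE.
have -> : 2 * 'C((2 * j).+2, 2)%:R * e - (2 * j).+2%:R * M = 2^-1 *
 (1 * M * (-2) ^+ 0 * (-1 * (2 * j).+2%:R) + (2 * j).+2%:R * m 1%N * (-2) ^+ 1
   * 0 +
   'C((2 * j).+2, 2)%:R * e * (-2 * -2) * 1 - M * (1 * (2 * j).+2%:R)).
  by rewrite expr0 expr1; field.
by rewrite E mulr0.
Qed.

(** Inserting the sum of all x_k^2, which is 1 on the sphere, writes the moment as a sum of mixed
    ones. By [moment_mixed] the n - 1 indices k other than i contribute equally. *)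
Lemma moment_rec (i : 'I_n) j :
  (2 * j + n)%:R * moment i j.+1 = (2 * j).+1%:R * moment i j.
Proof.
have mD := measurable_sphere.
have bm k : bmeas D (fun x : n.-tuple R => tnth x i ^+ (2 * j) * tnth x k ^+ 2).
  by apply: bmeasM; apply: bmeasX; exact: bmeas_coord.
have -> : moment i j = \sum_(k < n) Rintegral mu D
    (fun x : n.-tuple R => tnth x i ^+ (2 * j) * tnth x k ^+ 2).
  rewrite -Rintegral_sum //; apply: eq_Rintegral => x.
  rewrite inE /sphere /= => Dx; rewrite -mulr_sumr.
  by rewrite Dx mulr1.
rewrite mulr_sumr (bigD1 i) //=.
have -> : Rintegral mu D (fun x : n.-tuple R => tnth x i ^+ (2 * j) * tnth x i
  ^+ 2)
    = moment i j.+1.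
  by congr Rintegral; apply/funext => x; rewrite -exprD mulnS addnC.
under eq_bigr => k ki do rewrite moment_mixed 1?eq_sym //.
rewrite sumr_const cardC1 card_ord -[X in _ + X]mulr_natl -mulrDl -natrD;
  congr (_%:R * _).
by have := ltn_ord i; lia.
Qed.

Lemma moment0 (i : 'I_n) : moment i 0 = 1.
Proof.
rewrite /moment muln0 (_ : (fun x => _) = fun=> 1).
  exact: Rintegral_cst1 measurable_sphere sphere_mass 1.
by apply/funext => x; rewrite expr0.
Qed.

Lemma moment_poch (i : 'I_n) j :
  (moment i j)%:C = poch (1 / 2) j / poch (n%:R / 2) j.
Proof.
have n0 : 0 < n%:R :> C by rewrite ltr0n (leq_ltn_trans _ (ltn_ord i)).
have pn k : poch (n%:R / 2) k != 0 :> C by rewrite poch_neq0 // divr_gt0 //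
  ltr0n.
elim: j => [|j IH]; first by rewrite moment0 !poch0 divr1.
have nj : n%:R / 2 + j%:R != 0 :> C by have := pn j.+1;
  rewrite pochSr mulf_eq0 negb_or => /andP[].
have := congr1 (fun x : R => x%:C) (moment_rec i j); rewrite /=.
rewrite !rmorphM !rmorph_nat /= IH !pochSr.
have -> : (2 * j + n)%:R = 2 * (n%:R / 2 + j%:R) :> C by rewrite natrD natrM;
  field.
have -> : (2 * j).+1%:R = 2 * (1 / 2 + j%:R) :> C by rewrite -natr1 natrM;
  field.
move: (n%:R / 2 + j%:R) (poch (n%:R / 2) j) (pn j) nj => a p p0 a0 h.
have t0 : 2 != 0 :> C by rewrite pnatr_eq0.
apply: (mulfI (mulf_neq0 t0 a0)); rewrite h.
by field; rewrite a0 p0.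
Qed.

End SphereMoments.

(** * Zonal spherical functions *)

Section ZonalSeries.
Variable R : realType.
Local Notation C := R[i].
Local Notation normc := (@Normc.normc R).
Implicit Types (s z w sigma : C) (x y alpha : R).

Lemma cvg_normc (u : nat -> C) z : (fun n => normc (z - u n)) @ \oo --> (0 : R)
  ->
  u @ \oo --> z.
Proof.
move=> /cvgrPdist_le u0; apply/cvgrPdist_le => -[e e'].
rewrite ltcE /= => /andP[/eqP -> e0].
have := u0 e e0; apply: filterS => n.
rewrite sub0r normrN ger0_norm ?normc_ge0 // => h.
by rewrite -normcE_norm lecR.
Qed.

Lemma cvg_limn_normc (u : nat -> C) z :
  (fun n => normc (z - u n)) @ \oo --> (0 : R) -> cvgn u /\ limn u = z.
Proof.
move=> /cvg_normc uz; split; first by apply/cvg_ex; exists z.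
exact/cvg_lim.
Qed.

(** Serves the inner integral, in which y is fixed. *)
Lemma measurable_Re_cpow_Lambda alpha y s :
  measurable_fun setT (fun x => complex.Re (cpow (Lambda alpha x y) s)) /\
  measurable_fun setT (fun x => complex.Im (cpow (Lambda alpha x y) s)).
Proof.
have mL : measurable_fun setT (fun x => Lambda alpha x y).
  rewrite (_ : (fun x => _) = (fun x : R => (1 + y ^+ 2 * sinh alpha ^+ 2) +
    (sinh alpha ^+ 2 * x ^+ 2 + (- (2 * y * sinh alpha * cosh alpha)) * x))).
    apply: measurable_funD; first exact: measurable_cst.
    by apply: measurable_funD; apply: measurable_funM.
  by apply/funext => x; rewrite /Lambda; ring.
have mp : measurable_fun setT (fun x => Lambda alpha x y `^ complex.Re s).
  exact: (measurableT_comp (measurable_powR (complex.Re s)) mL).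
have ml : measurable_fun setT (fun x => complex.Im s * ln (Lambda alpha x y)).
  by apply: measurable_funM => //; exact: (measurableT_comp (@measurable_ln R)
    mL).
have mc : measurable_fun setT (@cos R) by apply: continuous_measurable_fun;
  exact: continuous_cos.
have ms : measurable_fun setT (@sin R) by apply: continuous_measurable_fun;
  exact: continuous_sin.
split.
  rewrite (_ : (fun x => _) = (fun x => Lambda alpha x y `^ complex.Re s *
    cos (complex.Im s * ln (Lambda alpha x y)))).
    by apply: measurable_funM => //; exact: measurableT_comp.
  by apply/funext => x; rewrite /cpow /= mul0r subr0.
rewrite (_ : (fun x => _) = (fun x => Lambda alpha x y `^ complex.Re s *
  sin (complex.Im s * ln (Lambda alpha x y)))).
  by apply: measurable_funM => //; exact: measurableT_comp.
by apply/funext => x; rewrite /cpow /= mul0r addr0.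
Qed.

End ZonalSeries.

(** * Termwise integration over one sphere *)

Section SphereSeries.
Variables (R : realType) (n : nat) (mu : probability (n.-tuple R) R).
Hypothesis mu_unif : uniform_on_sphere mu.
Variable i : 'I_n.
Local Notation D := (@sphere R n).
Local Notation C := R[i].
Local Notation normc := (@Normc.normc R).
Local Notation cint := (cintegral mu D).

Lemma cbmeas_even_monomial (c : C) m :
  cbmeas D (fun x : n.-tuple R => c * ((tnth x i)%:C ^+ 2) ^+ m).
Proof.
apply: cbmeasZ.
rewrite (_ : (fun x => _) = fun x : n.-tuple R => (tnth x i ^+ (2 * m))%:C).
  by apply: cbmeas_real; apply: bmeasX; exact: bmeas_coord.
by apply/funext => x; rewrite -exprM rmorphXn.
Qed.

Lemma cintegral_even_monomial (c : C) m :
  cint (fun x : n.-tuple R => c * ((tnth x i)%:C ^+ 2) ^+ m) =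
  c * (poch (1 / 2) m / poch (n%:R / 2) m).
Proof.
have mD := @measurable_sphere R n; have muD := sphere_mass mu_unif.
rewrite -(moment_poch mu_unif i m) /moment -cintegral_real // -cintegralZ //.
  by congr cintegral; apply/funext => x; rewrite -exprM rmorphXn.
by apply: cbmeas_real; apply: bmeasX; exact: bmeas_coord.
Qed.

(** Replaces F by its even part, for which the expansion in x^2 is available. *)
Lemma cintegral_sym (F : R -> C) :
  measurable_fun setT (fun x => complex.Re (F x)) ->
  measurable_fun setT (fun x => complex.Im (F x)) ->
  (exists B : R, forall x, `|x| <= 1 -> normc (F x) <= B) ->
  cbmeas D (fun u : n.-tuple R => (F (tnth u i) + F (- tnth u i)) / 2) /\
  cint (fun u : n.-tuple R => F (tnth u i)) =
  cint (fun u : n.-tuple R => (F (tnth u i) + F (- tnth u i)) / 2).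
Proof.
move=> mr mi [B FB].
have mD := @measurable_sphere R n; have muD := sphere_mass mu_unif.
have mN (f : R -> R) : measurable_fun setT f -> measurable_fun setT (fun x : R
  => f (- x)).
  by move=> mf; apply: measurableT_comp.
have bm (f : R -> R) : measurable_fun setT f -> (forall x, `|x| <= 1 -> `|f x|
  <= B) ->
    bmeas D (fun u : n.-tuple R => f (tnth u i)).
  move=> mf fB; split; last by exists B => u Du; apply: fB;
    exact: sphere_coord_le1.
  by apply: measurable_funTS; apply: measurableT_comp => //;
    exact: measurable_coord.
have br : bmeas D (fun u : n.-tuple R => complex.Re (F (tnth u i))).
  apply: (bm (fun x => complex.Re (F x))) => // x /FB; apply: le_trans.
  exact: Re_le_normc.
have bi : bmeas D (fun u : n.-tuple R => complex.Im (F (tnth u i))).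
  apply: (bm (fun x => complex.Im (F x))) => // x /FB; apply: le_trans.
  exact: Im_le_normc.
have brN : bmeas D (fun u : n.-tuple R => complex.Re (F (- tnth u i))).
  apply: (bm (fun x => complex.Re (F (- x))));
    first exact: (mN (fun x => complex.Re (F x))).
  by move=> x; rewrite -normrN => /FB; apply: le_trans; exact: Re_le_normc.
have biN : bmeas D (fun u : n.-tuple R => complex.Im (F (- tnth u i))).
  apply: (bm (fun x => complex.Im (F (- x))));
    first exact: (mN (fun x => complex.Im (F x))).
  by move=> x; rewrite -normrN => /FB; apply: le_trans; exact: Im_le_normc.
have bF : cbmeas D (fun u : n.-tuple R => F (tnth u i)) by split.
have bFN : cbmeas D (fun u : n.-tuple R => F (- tnth u i)) by split.
rewrite (_ : (fun u => (_ + _) / 2) =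
   fun u : n.-tuple R => 2^-1 * (F (tnth u i) + F (- tnth u i))); last first.
  by apply/funext => u; rewrite mulrC.
have bs := cbmeasD bF bFN.
split; first exact: cbmeasZ.
rewrite cintegralZ // cintegralD //.
have -> : cint (fun u : n.-tuple R => F (- tnth u i)) = cint (fun u => F (tnth
  u i)).
  rewrite /cintegral; congr (_ +i* _).
    exact: (Rintegral_reflect mu_unif mr br).
  exact: (Rintegral_reflect mu_unif mi bi).
by field.
Qed.

(** The even part of F is within the tail of [ga] of a polynomial in x^2, and this polynomial is
    integrated by its moments. An explicit rate, rather than a limit, is kept because it must be
    uniform in y for the outer integral. *)
Lemma cintegral_even_series (F : R -> C) (b : nat -> nat -> C) (ga : nat -> R)
  (S : R) :
  measurable_fun setT (fun x => complex.Re (F x)) ->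
  measurable_fun setT (fun x => complex.Im (F x)) ->
  (exists B : R, forall x, `|x| <= 1 -> normc (F x) <= B) ->
  (forall x, `|x| <= 1 -> dominated (fun l => \sum_(m < l.+1) b l m * (x%:C ^+
    2) ^+ m) ga
     ((F x + F (- x)) / 2) S) ->
  forall N, normc (cint (fun u : n.-tuple R => F (tnth u i)) -
    \sum_(l < N) \sum_(m < l.+1) b l m * (poch (1 / 2) m / poch (n%:R / 2) m))
   <= (S - series ga N) + (S - series ga N).
Proof.
move=> mr mi FB domF N.
have mD := @measurable_sphere R n; have muD := sphere_mass mu_unif.
have [bs ->] := cintegral_sym mr mi FB.
have -> : \sum_(l < N) \sum_(m < l.+1) b l m * (poch (1 / 2) m / poch (n%:R /
  2) m) =
  cint (fun u => \sum_(l < N) \sum_(m < l.+1) b l m * ((tnth u i)%:C ^+ 2) ^+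
    m).
  rewrite cintegral_sum //; last first.
    by move=> l; apply: cbmeas_sum => m; exact: cbmeas_even_monomial.
  apply: eq_bigr => l _; rewrite cintegral_sum //; last first.
    by move=> m; exact: cbmeas_even_monomial.
  by apply: eq_bigr => m _; rewrite cintegral_even_monomial.
apply: normc_cintegralB_le => //.
  apply: cbmeas_sum => l; apply: cbmeas_sum => m; exact: cbmeas_even_monomial.
move=> u Du; have [_ _ /(_ N)] := domF _ (sphere_coord_le1 i Du).
by rewrite /series /= big_mkord.
Qed.

End SphereSeries.

(** * The double integral, in general and for q = 1 *)

Section Zonal.
Variables (R : realType) (mu : forall n : nat, probability (n.-tuple R) R).
Hypothesis mu_unif : forall n : nat, (0 < n)%N -> uniform_on_sphere (mu n).
Local Notation C := R[i].
Local Notation normc := (@Normc.normc R).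
Implicit Types (sigma : C) (alpha : R).

Lemma cvg_dominated_rate (ga : nat -> R) (S : R) : series ga @ \oo --> S ->
  (fun N => (S - series ga N) + (S - series ga N)) @ \oo --> (0 : R).
Proof.
move=> gaS; rewrite -[0]addr0 -(subrr S).
by apply: cvgD; apply: cvgB => //; exact: cvg_cst.
Qed.

(** The factors (1/2)_m and (1/2)_n in the moments cancel those in the denominators of
    [mehler_term]; what is left has the lower parameters p / 2 and q / 2. *)
Lemma zonal_series (p q : nat) (i : 'I_p) (j : 'I_q) sigma alpha :
  let u : nat -> C := fun l => poch (1 / 2) l / l`!%:R *
    appellF2 l (- (sigma / 2)) (p%:R / 2) (q%:R / 2) * (tanh alpha)%:C ^+ (2 *
      l) in
  cvgn (series u) /\
  zonal mu i j sigma alpha = 1 / (cosh alpha)%:C * limn (series u).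
Proof.
set s := - (sigma / 2); set t := (tanh alpha)%:C;
  set ch := (cosh alpha)%:C => u.
have up : uniform_on_sphere (mu p) by apply: mu_unif;
  exact: leq_ltn_trans (ltn_ord i).
have uq : uniform_on_sphere (mu q) by apply: mu_unif;
  exact: leq_ltn_trans (ltn_ord j).
have ch0 : ch != 0.
  by rewrite (_ : 0 = 0%:C) // (inj_eq (@complexI R)) gt_eqF ?cosh_gt0.
have [ga0 [S0 domL]] := dominated_Lambda s alpha.
pose ga k := normc ch^-1 * ga0 k; pose S := normc ch^-1 * S0.
(* The part of index l has [A l m k] as coefficient of x^(2 m) y^(2 k), already divided by cosh
   alpha. *)
pose A l m k := ch^-1 * (poch s (m + k) * (binser (1 / 2) l * poch (- l%:R) m *
  poch (- l%:R) k / (m`!%:R * k`!%:R * (poch (1 / 2) m * poch (1 / 2) k)))) * t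
    ^+ (2 * l).
pose b (y : R) l m := \sum_(k < l.+1) A l m k * (y%:C ^+ 2) ^+ k.
pose Mp m : C := poch (1 / 2) m / poch (p%:R / 2) m.
pose Mq m : C := poch (1 / 2) m / poch (q%:R / 2) m.
pose F y x := cpow (Lambda alpha x y) (- s).
pose e N := (S - series ga N) + (S - series ga N).
have domF y x : `|y| <= 1 -> `|x| <= 1 ->
    dominated (fun l => \sum_(m < l.+1) b y l m * (x%:C ^+ 2) ^+ m) ga
      ((F y x + F y (- x)) / 2) S.
  move=> y1 x1; have := dominatedZ ch^-1 (domL x y x1 y1); congr dominated.
    apply/funext => l; rewrite /mehler_term /b mulr_suml mulr_sumr.
    apply: eq_bigr => m _; rewrite !mulr_suml mulr_sumr; apply: eq_bigr => k _.
    by rewrite /A -/t; ring.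
  by rewrite mulrC mulfK.
have e0 : e @ \oo --> (0 : R).
  (* The convergence of the majorant, independent of x and y, is read off at x = y = 0. *)
  have [y1] : `|0 : R| <= 1 by rewrite normr0.
  by have [_ gaS _] := domF 0 0 y1 y1; exact: cvg_dominated_rate.
pose I y := cintegral (mu p) (@sphere R p) (fun v => F y (tnth v i)).
have inner y N : `|y| <= 1 ->
    normc (I y - \sum_(l < N) \sum_(m < l.+1) b y l m * Mp m) <= e N.
  move=> y1; have [B FB] := cpow_Lambda_bounded s alpha.
  have [mr mi] := measurable_Re_cpow_Lambda alpha y (- s).
  apply: (cintegral_even_series up i mr mi) => [|x x1]; last exact: domF.
  by exists B => x x1; exact: FB.
pose J N (v : q.-tuple R) := \sum_(l < N) \sum_(m < l.+1) b (tnth v j) l m * Mp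
  m.
have bJ1 N (l : 'I_N) (m : 'I_l.+1) : cbmeas (@sphere R q)
    (fun v : q.-tuple R => b (tnth v j) l m * Mp m).
  rewrite (_ : (fun v => _) = fun v : q.-tuple R =>
     \sum_(k < l.+1) (A l m k * Mp m) * ((tnth v j)%:C ^+ 2) ^+ k).
    by apply: cbmeas_sum => k; exact: cbmeas_even_monomial.
  apply/funext => v; rewrite /b mulr_suml; apply: eq_bigr => k _; ring.
have bJ N : cbmeas (@sphere R q) (J N).
  by apply: cbmeas_sum => l; apply: cbmeas_sum => m; exact: bJ1.
have mD := @measurable_sphere R q; have muD := sphere_mass uq.
have le1 (v : q.-tuple R) : @sphere R q v -> `|tnth v j| <= 1.
  exact: sphere_coord_le1.
(* The rate [e] is uniform in y, so the inner integral inherits measurability and boundedness from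
   polynomials in y^2. *)
have bI : cbmeas (@sphere R q) (fun v : q.-tuple R => I (tnth v j)).
  apply: (cbmeas_unif_lim bJ _ e0) => N v /le1; exact: inner.
have intJ N : cintegral (mu q) (@sphere R q) (J N) = \sum_(l < N) ch^-1 * u l.
  rewrite cintegral_sum //; last by move=> l; apply: cbmeas_sum => m;
    exact: bJ1.
  apply: eq_bigr => l _; rewrite cintegral_sum //.
  rewrite /u /appellF2 mulr_sumr mulr_suml mulr_sumr; apply: eq_bigr => m _.
  transitivity (cintegral (mu q) (@sphere R q) (fun v : q.-tuple R =>
     \sum_(k < l.+1) (A l m k * Mp m) * ((tnth v j)%:C ^+ 2) ^+ k)).
    congr cintegral; apply/funext => v; rewrite /b mulr_suml;
      apply: eq_bigr => k _; ring.
  rewrite cintegral_sum; [|exact: mD|exact: muD|by move=> k;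
    exact: cbmeas_even_monomial].
  rewrite mulr_sumr mulr_suml mulr_sumr; apply: eq_bigr => k _.
  rewrite cintegral_even_monomial // /A /Mp /binser.
  have half0 n : poch (1 / 2) n != 0 :> C by rewrite poch_neq0 // divr_gt0 //
    ltr0n.
  have p0 n : poch (p%:R / 2) n != 0 :> C.
    by rewrite poch_neq0 // divr_gt0 // ltr0n (leq_ltn_trans _ (ltn_ord i)).
  have q0 n : poch (q%:R / 2) n != 0 :> C.
    by rewrite poch_neq0 // divr_gt0 // ltr0n (leq_ltn_trans _ (ltn_ord j)).
  move: (poch (p%:R / 2) m) (p0 m) (poch (q%:R / 2) k) (q0 k) => P P0 Q Q0.
  by field; rewrite !half0 !fact_neq0 ch0 P0 Q0.
have Zlim : (fun N => normc (zonal mu i j sigma alpha * ch - series u N)) @ \oo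
  --> (0 : R).
  apply: (@squeeze_cvgr _ _ _ _ (fun=> 0) (fun N => (e N + e N) * normc ch));
    last 2 first.
  - exact: cvg_cst.
  - rewrite -[0](mul0r (normc ch)); apply: cvgM; last exact: cvg_cst.
    by rewrite -[0]addr0; exact: cvgD.
  apply: nearW => N; rewrite normc_ge0 /=.
  have -> : zonal mu i j sigma alpha =
      cintegral (mu q) (@sphere R q) (fun v : q.-tuple R => I (tnth v j)).
    by rewrite /zonal /I /F /s opprK.
  have -> : series u N = (\sum_(l < N) ch^-1 * u l) * ch.
    by rewrite -mulr_sumr mulrAC mulVf // mul1r /series /= big_mkord.
  rewrite -intJ -mulrBl Normc.normcM ler_wpM2r ?normc_ge0 //.
  by apply: normc_cintegralB_le => // v /le1; exact: inner.
have [cu limu] := cvg_limn_normc Zlim; split; first exact: cu.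
by rewrite limu div1r mulrC mulfK.
Qed.

(** The duplication formula; it splits (- sigma)_(2 l) into the two upper parameters of the 2F1. *)
Lemma poch_double (a : C) l : poch a (2 * l) = 4 ^+ l * poch (a / 2) l * poch
  ((1 + a) / 2) l.
Proof.
elim: l => [|l IH]; first by rewrite muln0 !poch0 expr0 !mulr1.
rewrite mulnS !pochSr IH exprS.
have -> : a + (2 * l)%:R = 2 * (a / 2 + l%:R) by rewrite natrM; field.
have -> : a + (2 * l).+1%:R = 2 * ((1 + a) / 2 + l%:R) by rewrite -natr1 natrM;
  field.
by ring.
Qed.

(** [zonal_series] with q = 1 would give an F_2 with lower parameters 2 and 1/2 and the prefactor 1
    / cosh alpha; the form with (cosh alpha)^sigma comes from expanding the perfect square
    directly. *)
Lemma zonal41 (i : 'I_4) (j : 'I_1) sigma alpha :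
  let u := pFq_term [:: - (sigma / 2); (1 - sigma) / 2] [:: 2] ((tanh alpha)%:C
    ^+ 2) in
  cvgn (series u) /\
  zonal mu i j sigma alpha = limn (series u) * cpow (cosh alpha) sigma.
Proof.
move=> u; set t := tanh alpha; set K := cpow (cosh alpha) sigma.
have c0 := cosh_gt0 alpha.
have K0 : K != 0.
  have := cpowN sigma c0; rewrite -/K => /eqP; apply: contraTneq => ->.
  by rewrite mul0r eq_sym oner_eq0.
have u4 : uniform_on_sphere (mu 4) by exact: mu_unif.
have u1 : uniform_on_sphere (mu 1) by exact: mu_unif.
have [M sM] := normc_bound (- sigma).
pose al k := 'C(M + k, k)%:R * `|t| ^+ k : R.
pose ga k := normc K * (al k.*2 + al k.*2.+1).
pose S := normc K * limn (series al).
(* With y^2 = 1 the coefficient of t^(2 l) is a single monomial in x^2, of degree m = l. *)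
pose b l m := if m == l then K * (binser (- sigma) l.*2 * t%:C ^+ (2 * l)) else
  0.
pose F y x := cpow (Lambda alpha x y) (sigma / 2).
have sumb (x : nat -> C) l : \sum_(m < l.+1) b l m * x m = K * (binser (-
  sigma) l.*2 * t%:C ^+ (2 * l)) * x l.
  rewrite big_ord_recr /= /b eqxx big1 ?add0r // => m _.
  by rewrite (ltn_eqF (ltn_ord m)) mul0r.
have Fval (y x : R) : y ^+ 2 = 1 -> `|x| <= 1 -> F y x = K * cpow (1 - x * y *
  t) sigma.
  move=> y2 x1; have y1 : `|x * y| <= 1.
    rewrite normrM; have -> : `|y| = 1 by apply/eqP;
      rewrite -sqrp_eq1 // real_normK ?num_real // y2.
    by rewrite mulr1.
  have w0 := onemM_gt0 alpha y1.
  have -> : F y x = cpow ((cosh alpha * (1 - x * y * t)) * (cosh alpha * (1 - x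
    * y * t))) (sigma / 2).
    rewrite /F; congr cpow; rewrite /Lambda y2.
    have cc : cosh alpha != 0 by rewrite gt_eqF.
    transitivity (cosh alpha ^+ 2 - 2 * x * y * sinh alpha * cosh alpha + x ^+
      2 * y ^+ 2 * sinh alpha ^+ 2).
      by rewrite -(subrK (sinh alpha ^+ 2) (cosh alpha ^+ 2)) cosh2B_sinh2 y2;
        ring.
    by rewrite /t /tanh; field.
  have ww := mulr_gt0 c0 w0.
  by rewrite (cpowM _ ww ww) -cpowD // -splitr (cpowM _ c0 w0).
have domF y x : y ^+ 2 = 1 -> `|x| <= 1 ->
    dominated (fun l => \sum_(m < l.+1) b l m * (x%:C ^+ 2) ^+ m) ga ((F y x +
      F y (- x)) / 2) S.
  move=> y2 x1.
  have xyt : `|x * y * t| <= `|t|.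
    rewrite !normrM; have -> : `|y| = 1 by apply/eqP;
      rewrite -sqrp_eq1 // real_normK ?num_real // y2.
    by rewrite mulr1 ler_piMl.
  have d1 := dominated_binser sM xyt (tanh_lt1 alpha).
  have d2 : dominated (fun k => (-1) ^+ k * (binser (- sigma) k * (x * y *
    t)%:C ^+ k)) al
      (cpow (1 - - (x * y * t)) (- - sigma)) (limn (series al)).
    have := dominated_binser sM (_ : `|- (x * y * t)| <= `|t|) (tanh_lt1 alpha).
    rewrite normrN => /(_ xyt); congr dominated; apply/funext => k.
    have -> : (- (x * y * t))%:C = - (x * y * t)%:C by rewrite rmorphN.
    by rewrite [in LHS]exprNn mulrCA.
  have := dominatedZ K (dominated_even d1 d2); congr dominated.
    apply/funext => l; rewrite sumb -[RHS]mulrA; congr (_ * _);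
      rewrite -[RHS]mulrA; congr (_ * _).
    have cM (a c : R) : (a * c)%:C = a%:C * c%:C by rewrite rmorphM.
    rewrite (cM (x * y) t) (cM x y).
    have yy : y%:C ^+ 2 = 1 by rewrite -rmorphXn y2 rmorph1.
    rewrite -mul2n [LHS]exprMn [X in X * _]exprMn [y%:C ^+ (2 * l)]exprM yy
      expr1n mulr1.
    by rewrite [x%:C ^+ (2 * l)]exprM mulrC.
  by rewrite !Fval ?normrN // opprK !mulNr -mulrDr mulrA.
have e0 : (fun N => (S - series ga N) + (S - series ga N)) @ \oo --> (0 : R).
  have z1 : `|0 : R| <= 1 by rewrite normr0.
  by have [_ gaS _] := domF 1 0 (expr1n _ _) z1; exact: cvg_dominated_rate.
(* The (1/2)_l of the moment cancels against (2 l)!, and the dimension 4 gives the lower parameter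
   2. *)
have uE l : \sum_(m < l.+1) b l m * (poch (1 / 2) m / poch (4%:R / 2) m) = K *
  u l.
  rewrite (sumb (fun m => poch (1 / 2) m / poch (4%:R / 2) m)) -mulrA;
    congr (_ * _).
  rewrite /u /pFq_term !big_cons !big_nil !mulr1 -exprM /binser -mul2n
    poch_double.
  have -> : (2 * l)`!%:R = 4 ^+ l * poch (1 / 2) l * l`!%:R :> C.
    by rewrite -poch1 poch_double (_ : (1 + 1) / 2 = 1) ?poch1 // divff //
      pnatr_eq0.
  have -> : - sigma / 2 = - (sigma / 2) by rewrite mulNr.
  have -> : 4%:R / 2 = 2 :> C by field.
  have half0 : poch (1 / 2) l != 0 :> C by rewrite poch_neq0 // divr_gt0 //
    ltr0n.
  have two0 : poch 2 l != 0 :> C by rewrite poch_neq0 // ltr0n.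
  have four0 : 4 ^+ l != 0 :> C by rewrite expf_neq0 // pnatr_eq0.
  by field; rewrite half0 two0 four0 fact_neq0.
pose I y := cintegral (mu 4) (@sphere R 4) (fun v => F y (tnth v i)).
have inner (y : R) : y ^+ 2 = 1 -> (fun N => normc (I y / K - series u N)) @
  \oo --> (0 : R).
  move=> y2; have y1 : `|y| <= 1.
    by rewrite -(@ler_pXn2r _ 2) ?nnegrE // expr1n real_normK ?num_real // y2.
  have [B FB] := cpow_Lambda_bounded (- (sigma / 2)) alpha.
  have [mr mi] := measurable_Re_cpow_Lambda alpha y (sigma / 2).
  have bound N : normc (I y - K * series u N) <= (S - series ga N) + (S -
    series ga N).
    have FB' : exists B : R, forall x, `|x| <= 1 -> normc (F y x) <= B.
      by exists B => x x1; have := FB x y x1 y1; rewrite opprK.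
    have := @cintegral_even_series R 4 (mu 4) u4 i (F y) b ga S mr mi FB'
      (fun x => domF y x y2) N.
    rewrite [X in _ - X](eq_bigr (fun l : 'I_N => K * u l));
      last by move=> l _; exact: uE.
    by rewrite -mulr_sumr -(big_mkord xpredT u).
  apply: (@squeeze_cvgr _ _ _ _ (fun=> 0) (fun N =>
    normc K^-1 * ((S - series ga N) + (S - series ga N)))); last 2 first.
  - exact: cvg_cst.
  - by rewrite -[0](mulr0 (normc K^-1)); apply: cvgM => //; exact: cvg_cst.
  apply: nearW => N; rewrite normc_ge0 /=.
  have -> : I y / K - series u N = K^-1 * (I y - K * series u N).
    by rewrite mulrBr mulKf // mulrC.
  by rewrite (Normc.normcM K^-1) ler_wpM2l ?normc_ge0.
have lim_u (y : R) : y ^+ 2 = 1 -> cvgn (series u) /\ I y = limn (series u) * K.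
  move=> y2; have [cu limu] := cvg_limn_normc (inner y y2).
  by split; [exact: cu|rewrite limu divfK].
split; first by case: (lim_u 1 (expr1n _ _)).
have mD := @measurable_sphere R 1; have muD := sphere_mass u1.
have cst_int z : cintegral (mu 1) (@sphere R 1) (fun=> z) = z.
  by rewrite /cintegral !Rintegral_cst1 //; case: z.
(* Both points of S^0 have y^2 = 1, so the inner integral takes one value there and the outer one
   returns it. *)
rewrite -[RHS]cst_int; apply: eq_cintegral => v;
  rewrite /sphere /= big_ord1 => v1.
have vj : tnth v j ^+ 2 = 1.
  by rewrite -v1; congr (tnth _ _ ^+ _); apply: val_inj; case: (j) => -[].
by have [_ <-] := lim_u _ vj.
Qed.

End Zonal.

(** * The 3F2 coefficients and the three groups *)

(** This is [hyp3F2_sum] at s = - sigma / 2, multiplied by (1/2)_l and divided by l!^2 (c)_l. *)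
Lemma term_3F2 (R : realType) (sigma c : R[i]) l : 0 < c ->
  (forall m, (m <= l)%N -> poch (1 - c - sigma / 2 - l%:R) m != 0 /\
     poch (- (sigma / 2) - l%:R) m != 0) ->
  poch (1 / 2) l * poch (c + sigma / 2) l * poch (sigma / 2 + 1) l
     / (l`!%:R ^+ 2 * poch c l) *
  hyp3F2 (- (sigma / 2)) (- l%:R) (- l%:R)
    (1 - c - sigma / 2 - l%:R) (- (sigma / 2) - l%:R) 1 =
  poch (1 / 2) l / l`!%:R * appellF2 l (- (sigma / 2)) c 1.
Proof.
move=> c0 nz; have := @hyp3F2_sum R l (- (sigma / 2)) c c0 nz.
rewrite !opprK [1 + sigma / 2]addrC => h.
have pc := poch_neq0 l c0.
rewrite mulrAC; set H := hyp3F2 _ _ _ _ _ _ in h *.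
transitivity (poch (1 / 2) l * (poch (c + sigma / 2) l * poch (sigma / 2 + 1) l
  * H)
  / (l`!%:R ^+ 2 * poch c l)); first by rewrite !mulrA.
by rewrite h; field; rewrite pc fact_neq0.
Qed.

Theorem mainTheorem4 (R : realType)
    (mu : forall n : nat, probability (n.-tuple R) R)
    (mu_unif : forall n : nat, (0 < n)%N -> uniform_on_sphere (mu n))
    (sigma : R[i]) (alpha : R) :
  let ch : R[i] := (cosh alpha)%:C in
  let th : R[i] := (tanh alpha)%:C in
  (* SO(4,1) *)
  (forall (i : 'I_4) (j : 'I_1),
     cvgn (series (pFq_term [:: - (sigma / 2); (1 - sigma) / 2] [:: 2]
                            (th ^+ 2))) /\
     zonal mu i j sigma alpha =
       hyp2F1 (- (sigma / 2)) ((1 - sigma) / 2) 2 (th ^+ 2)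
         * cpow (cosh alpha) sigma) /\
  (* SO(3,2) *)
  (forall (i : 'I_3) (j : 'I_2),
     (let u : nat -> R[i] := fun l =>
        poch (1 / 2) l / l`!%:R
          * appellF2 l (- (sigma / 2)) (3 / 2) 1 * th ^+ (2 * l) in
      cvgn (series u) /\
      zonal mu i j sigma alpha = 1 / ch * limn (series u)) /\
     ((forall l m : nat, (m <= l)%N ->
         poch (- ((sigma + 1) / 2) - l%:R) m != 0 /\
         poch (- (sigma / 2) - l%:R) m != 0) ->
      let u : nat -> R[i] := fun l =>
        poch (1 / 2) l * poch ((3 + sigma) / 2) l * poch (sigma / 2 + 1) l
            / (l`!%:R ^+ 2 * poch (3 / 2) l)
          * hyp3F2 (- (sigma / 2)) (- l%:R) (- l%:R)
                   (- ((sigma + 1) / 2) - l%:R) (- (sigma / 2) - l%:R) 1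
          * th ^+ (2 * l) in
      cvgn (series u) /\
      zonal mu i j sigma alpha = 1 / ch * limn (series u))) /\
  (* SO(4,2); Gamma(l + 2) is the factorial of l + 1 *)
  (forall (i : 'I_4) (j : 'I_2),
     (let u : nat -> R[i] := fun l =>
        poch (1 / 2) l / l`!%:R
          * appellF2 l (- (sigma / 2)) 2 1 * th ^+ (2 * l) in
      cvgn (series u) /\
      zonal mu i j sigma alpha = 1 / ch * limn (series u)) /\
     ((forall l m : nat, (m <= l)%N ->
         poch (- (sigma / 2) - l%:R - 1) m != 0 /\
         poch (- (sigma / 2) - l%:R) m != 0) ->
      let u : nat -> R[i] := fun l =>
        poch (1 / 2) l * poch (sigma / 2 + 2) l * poch (sigma / 2 + 1) l
            / (l`!%:R ^+ 2 * (l.+1)`!%:R)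
          * hyp3F2 (- (sigma / 2)) (- l%:R) (- l%:R)
                   (- (sigma / 2) - l%:R - 1) (- (sigma / 2) - l%:R) 1
          * th ^+ (2 * l) in
      cvgn (series u) /\
      zonal mu i j sigma alpha = 1 / ch * limn (series u))).
Proof.
move=> ch th.
have two_half : 2%:R / 2 = 1 :> R[i] by rewrite divff // pnatr_eq0.
have four_half : 4%:R / 2 = 2 :> R[i] by field.
(* For q = 2 the lower parameter q / 2 is 1, the value at which F_2 reduces to a 3F2. *)
have series_eq (p : nat) (i : 'I_p) (j : 'I_2) (u : nat -> R[i]) :
    (forall l, u l = poch (1 / 2) l / l`!%:R *
       appellF2 l (- (sigma / 2)) (p%:R / 2) 1 * th ^+ (2 * l)) ->
    cvgn (series u) /\ zonal mu i j sigma alpha = 1 / ch * limn (series u).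
  move=> /funext ->; have := zonal_series mu_unif i j sigma alpha.
  by rewrite two_half.
have three_gt0 : 0 < 3%:R / 2 :> R[i] by rewrite divr_gt0 // ltr0n.
have two_gt0 : 0 < 2 :> R[i] by rewrite ltr0n.
split; first by move=> i j; exact: zonal41.
split=> i j; split.
- by apply: series_eq.
- move=> nz u; apply: series_eq => l; rewrite /u; congr (_ * _).
  rewrite (_ : (3 + sigma) / 2 = 3%:R / 2 + sigma / 2); last by rewrite mulrDl.
  have lower : - ((sigma + 1) / 2) - l%:R = 1 - 3%:R / 2 - sigma / 2 - l%:R by
    field.
  rewrite lower; apply: term_3F2 => // m ml.
  by have := nz l m ml; rewrite lower.
- by move=> u; apply: series_eq => l; rewrite /u four_half.
- move=> nz u; apply: series_eq => l; rewrite /u four_half; congr (_ * _).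
  rewrite [sigma / 2 + 2]addrC.
  have -> : (l.+1)`!%:R = poch 2 l :> R[i].
    by rewrite -poch1 pochSl mul1r.
  have lower : - (sigma / 2) - l%:R - 1 = 1 - 2 - sigma / 2 - l%:R by ring.
  rewrite lower; apply: term_3F2 => // m ml.
  by have := nz l m ml; rewrite lower.
Qed.
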